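(* Let $G$ be a finite simple graph, let $\pi$ be a vertex clique-partition of $G$, let $e_\pi$ be a clique cluster-partition of $V(G)$ based on $\pi$, and let $G^{md}$ be a multiple clique cluster-whiskered graph on $G$ with respect to $e_\pi$. Let $k$ be a field and let $S$ be the polynomial ring over $k$ whose variables are indexed by the vertices of $G^{md}$. Then the edge ideal $I(G^{md})\subseteq S$ is sequentially Cohen-Macaulay, i.e. $S/I(G^{md})$ is a sequentially Cohen-Macaulay $S$-module.
   Context: All graphs are finite and simple. The edge ideal of a graph $H$ is $I(H)=\langle x_ux_v\mid \{u,v\}\in E(H)\rangle$; it equals the Stanley-Reisner ideal of the independence complex ${\rm Ind}\,H$, whose faces are the independent vertex sets of $H$. Vertex decomposable (nonpure sense): a simplicial complex $\Delta$ is vertex decomposable if either $\Delta$ is a simplex, or there is a vertex $x$ of $\Delta$ such that $(\alpha)$ both $\Delta\smallsetminus x=\{F\in\Delta\mid x\notin F\}$ and ${\rm lk}_\Delta(x)=\{F\in\Delta\mid x\notin F,\ F\cup\{x\}\in\Delta\}$ are vertex decomposable, and $(\beta)$ no facet of ${\rm lk}_\Delta(x)$ is a facet of $\Delta\smallsetminus x$. A graph $H$ is called vertex decomposable if ${\rm Ind}\,H$ is vertex decomposable. Vertex clique-partition: a partition $\pi=\{W_1,\ldots,W_d\}$ of $V(G)$ into nonempty sets such that each $W_i$ induces a complete subgraph of $G$. Clique cluster-partition based on $\pi$: a partition $e_\pi=\{U_1,\ldots,U_s\}$ of $V(G)$ into nonempty sets such that (1) for all $i,j$, either $W_i\subseteq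 U_j$ or $W_i\cap U_j=\emptyset$; (2) for distinct $i,j$, if $W_i\cup W_j\subseteq U_k$ for some $k$, then $G$ has no edge between $W_i$ and $W_j$. Number the $U_j$ so that $U_1,\ldots,U_r$ are those containing more than one of the sets $W_l$, while each of $U_{r+1},\ldots,U_s$ equals a single $W_l$. Multiple clique cluster-whiskered graph $G^{md}$ (of type $(d,r)$) with respect to $e_\pi$: choose finite nonempty sets $A_1,\ldots,A_d,B_1,\ldots,B_r$, mutually disjoint and disjoint from $V(G)$. The vertex set is $V(G^{md})=V(G)\cup A_1\cup\cdots\cup A_d\cup B_1\cup\cdots\cup B_r$. The edges are: all edges of $G$; all edges between $A_i$ and $W_i$ (so that $W_i\cup\{a\}$ is a clique for each $a\in A_i$), $1\le i\le d$; all edges between $B_j$ and $U_j$, $1\le j\le r$; and, inside each $A_i$ and inside each $B_j$, an arbitrary set of edges such that the subgraph induced on $A_i$ (respectively on $B_j$) is a vertex decomposable graph. There are no other edges. *)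

(* Defs.v *)
From HB Require Import structures.
From mathcomp Require Import all_boot all_order all_algebra.
From mathcomp.multinomials Require Import mpoly.

Set Implicit Arguments.
Unset Strict Implicit.
Unset Printing Implicit Defensive.

Import GRing.Theory.
Local Open Scope ring_scope.

Record sgraph (V : finType) := SGraph {
  edge :> rel V;
  edge_sym : ssrbool.symmetric edge;
  edge_irr : irreflexive edge }.

Section Complexes.
Variable T : finType.
Implicit Types (D : {set {set T}}) (F : {set T}) (x : T).

Definition deletion D x := [set F in D | x \notin F].

Definition link D x := [set F in D | (x \notin F) && (x |: F \in D)].

Definition facet D F := maxset (fun E => E \in D) F.

(* The simplex on the empty set, i.e. the complex [set set0], is included. *)
Inductive vertex_decomposable : {set {set T}} -> Prop :=
| vd_simplex F : vertex_decomposable (powerset F)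
| vd_shedding D x :
    [set x] \in D ->
    vertex_decomposable (deletion D x) ->
    vertex_decomposable (link D x) ->
    (forall F, facet (link D x) F -> ~~ facet (deletion D x) F) ->
    vertex_decomposable D.

Definition Ind (H : sgraph T) : {set {set T}} :=
  [set F : {set T} | [forall u in F, forall v in F, ~~ H u v]].

Definition vd_graph (H : sgraph T) := vertex_decomposable (Ind H).

End Complexes.

Section Partitions.
Variables (V : finType) (G : sgraph V).

(* P enumerates without repetition the blocks of a partition of V; [partition]
   demands in particular that the blocks be nonempty. *)
Definition indexed_partition (n : nat) (P : 'I_n -> {set V}) : Prop :=
  injective P /\ partition [set P i | i : 'I_n] [set: V].

Definition clique_partition (d : nat) (W : 'I_d -> {set V}) : Prop :=
  indexed_partition W /\
  forall i u v, u \in W i -> v \in W i -> u != v -> G u v.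

Definition cluster_partition (d s : nat)
    (W : 'I_d -> {set V}) (U : 'I_s -> {set V}) : Prop :=
  [/\ indexed_partition U,
      forall i j, (W i \subset U j) \/ [disjoint W i & U j]
    & forall i j k, i != j -> W i :|: W j \subset U k ->
        forall u v, u \in W i -> v \in W j -> ~~ G u v].

(* The blocks of U containing more than one block of W are exactly the
   first r ones. *)
Definition clusters_first (d s : nat)
    (W : 'I_d -> {set V}) (U : 'I_s -> {set V}) (r : nat) : Prop :=
  forall j : 'I_s, (j < r)%N = (1 < #|[set i | W i \subset U j]|)%N.

End Partitions.

Definition tagged_edge (I : finType) (A : I -> finType)
    (GA : forall i, sgraph (A i)) : rel {i : I & A i} :=
  fun a b => (tag a == tag b) && GA (tag a) (tagged a) (tagged_as a b).

Section Whiskering.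
Variables (V : finType) (G : sgraph V) (d s r : nat).
Variables (W : 'I_d -> {set V}) (U : 'I_s -> {set V}) (r_le_s : (r <= s)%N).
Variables (A : 'I_d -> finType) (B : 'I_r -> finType).
Variables (GA : forall i, sgraph (A i)) (GB : forall j, sgraph (B j)).

Definition md_vertex : finType := (V + ({i : 'I_d & A i} + {j : 'I_r & B j}))%type.

Definition md_edge : rel md_vertex := fun x y =>
  match x, y with
  | inl u, inl v => G u v
  | inl u, inr (inl a) | inr (inl a), inl u => u \in W (tag a)
  | inl u, inr (inr b) | inr (inr b), inl u => u \in U (widen_ord r_le_s (tag b))
  | inr (inl a), inr (inl a') => tagged_edge GA a a'
  | inr (inr b), inr (inr b') => tagged_edge GB b b'
  | inr (inl _), inr (inr _) | inr (inr _), inr (inl _) => false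
  end.

Lemma tagged_edge_sym (I : finType) (C : I -> finType)
  (GC : forall i, sgraph (C i)) : ssrbool.symmetric (tagged_edge GC).
Proof.
move=> [i a] [j b]; rewrite /tagged_edge /=.
case: (eqVneq i j) b => [<-|neq_ij] b /=.
  by rewrite !tagged_asE edge_sym.
by [].
Qed.

Lemma tagged_edge_irr (I : finType) (C : I -> finType)
  (GC : forall i, sgraph (C i)) : irreflexive (tagged_edge GC).
Proof. by move=> [i a]; rewrite /tagged_edge /= tagged_asE edge_irr andbF. Qed.

Lemma md_edge_sym : ssrbool.symmetric md_edge.
Proof.
by case=> [u|[a|b]] [v|[a'|b']] //;
  [exact: edge_sym | exact: tagged_edge_sym | exact: tagged_edge_sym].
Qed.

Lemma md_edge_irr : irreflexive md_edge.
Proof.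
by case=> [u|[a|b]];
  [exact: edge_irr | exact: tagged_edge_irr | exact: tagged_edge_irr].
Qed.

Definition md_graph : sgraph md_vertex := SGraph md_edge_sym md_edge_irr.

End Whiskering.

(* For submodules N' of N of an R-module M, the following definitions are about
   the subquotient R-module N / N'; its elements are represented by elements
   of N. *)
Section Subquotients.
Variables (R : comNzRingType) (M : lmodType R).
Implicit Types (N : M -> Prop) (fs : seq R).

Definition submodule N : Prop :=
  [/\ N 0, forall u v, N u -> N v -> N (u + v)
    & forall a u, N u -> N (a *: u)].

Definition span (X : M -> Prop) : M -> Prop := fun u =>
  exists2 cs : seq (R * M),
    forall c, c \in cs -> X c.2 & u = \sum_(c <- cs) c.1 *: c.2.

Definition annihilator N N' : R -> Prop :=
  fun a => forall u, N u -> N' (a *: u).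

(* The submodule N' + f N; thus N / add_mul N N' f is (N / N') / f (N / N'). *)
Definition add_mul N N' (f : R) : M -> Prop :=
  fun u => exists v w, [/\ N v, N' w & u = w + f *: v].

Fixpoint regular_sequence N N' fs : Prop :=
  if fs is f :: fs' then
    (forall u, N u -> N' (f *: u) -> N' u) /\
    regular_sequence N (add_mul N N' f) fs'
  else exists2 u, N u & ~ N' u.

(* d is the depth of N / N' with respect to the ideal m. *)
Definition has_depth (m : R -> Prop) N N' (d : nat) : Prop :=
  let regular fs := (forall f, f \in fs -> m f) /\ regular_sequence N N' fs in
  (exists2 fs, size fs = d & regular fs) /\
  (forall fs, regular fs -> (size fs <= d)%N).

End Subquotients.

Section Dimension.
Variable R : comNzRingType.

Definition ideal (I : R -> Prop) : Prop := @submodule R R^o I.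

Definition prime_ideal (P : R -> Prop) : Prop :=
  [/\ ideal P, ~ P 1 & forall a b, P (a * b) -> P a \/ P b].

(* A chain P 0 < P 1 < ... < P l of primes containing I. *)
Definition prime_chain (I : R -> Prop) (l : nat) (P : nat -> R -> Prop) : Prop :=
  [/\ forall i, (i <= l)%N -> prime_ideal (P i),
      forall a, I a -> P 0 a
    & forall i, (i < l)%N ->
        (forall a, P i a -> P i.+1 a) /\ exists2 a, P i.+1 a & ~ P i a].

(* d is the Krull dimension of N / N', i.e. of R / ann (N / N'). *)
Definition has_dim (M : lmodType R) (N N' : M -> Prop) (d : nat) : Prop :=
  (exists P, prime_chain (annihilator N N') d P) /\
  (forall l P, prime_chain (annihilator N N') l P -> (l <= d)%N).

End Dimension.

Section SequentiallyCM.
Variables (k : fieldType) (n : nat).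
Local Notation S := {mpoly k[n]}.

Definition max_ideal : S -> Prop := fun f => f@_0%MM = 0.

Definition graded_ideal (J : S -> Prop) : Prop :=
  ideal J /\ forall f e, J f -> J (pihomog mdeg e f).

(* J / J' is Cohen-Macaulay; in particular it is nonzero. *)
Definition Cohen_Macaulay (J J' : S -> Prop) : Prop :=
  exists d, @has_dim S S^o J J' d /\ @has_depth S S^o max_ideal J J' d.

Definition dim_lt (J1 J1' J2 J2' : S -> Prop) : Prop :=
  exists d1 d2, [/\ @has_dim S S^o J1 J1' d1, @has_dim S S^o J2 J2' d2
    & (d1 < d2)%N].

(* S / I is sequentially Cohen-Macaulay: it has a filtration
   0 = M_0 < M_1 < ... < M_l = S / I by graded submodules with Cohen-Macaulay
   quotients M_i+1 / M_i of strictly increasing dimensions.  The graded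
   submodules of S / I are the J / I with J a graded ideal containing I. *)
Definition sequentially_CM (I : S -> Prop) : Prop :=
  exists (l : nat) (J : nat -> S -> Prop),
    [/\ forall f, J 0 f <-> I f,
        forall f, J l f,
        forall i, (i <= l)%N -> graded_ideal (J i),
        forall i, (i < l)%N ->
          (forall f, J i f -> J i.+1 f) /\ Cohen_Macaulay (J i.+1) (J i)
      & forall i, (i.+1 < l)%N -> dim_lt (J i.+1) (J i) (J i.+2) (J i.+1)].

End SequentiallyCM.

Definition edge_ideal (k : fieldType) (T : finType) (H : sgraph T) :
    {mpoly k[#|T|]} -> Prop :=
  @span {mpoly k[#|T|]} {mpoly k[#|T|]}^o
    (fun f => exists u v : T, H u v /\ f = 'X_(enum_rank u) * 'X_(enum_rank v)).
Arguments edge_ideal k {T} H _.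

(* Main.v *)
Require Import Defs.
From mathcomp Require Import all_boot all_order all_algebra ring zify.
From mathcomp.multinomials Require Import mpoly.
From Stdlib Require Import FunctionalExtensionality PropExtensionality.

(** A whisker vertex attached to a clique is dominated by every vertex of that
    clique, so the vertices of [V] can be shed one after another; what is left is
    a disjoint union of the vertex decomposable whisker graphs, hence the
    independence complex of the whole graph is vertex decomposable.

    Let [D(e)] be the subcomplex generated by the faces with at least [e] vertices.
    Along shedding vertices one shells [D(e)] from [D(e+1)] by facets with exactly
    [e] vertices.  Algebraically, the module [I(D(e+1)) / I(D(e))] is filtered
    with factors [S / P], each [P] being generated by all but [e] of the variables.
    On such modules the elementary symmetric polynomials of degrees [e], ..., [1]
    form a regular sequence: the one of degree [e] acts on [S / P] as the product
    of the [e] remaining variables, and [S / P] modulo this product is filtered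
    with factors of the same kind for [e - 1].

    Conversely neither a regular sequence nor a chain of primes can be longer than
    [e]: both yield elements without nonzero polynomial relation, whereas only
    O(t^e) monomials of degree at most [t] have a support with at most [e]
    variables.  So the nonzero quotients are Cohen-Macaulay of dimension [e], and
    the ideals of the complexes [D(e)] form the required filtration. *)

Set Implicit Arguments.
Unset Strict Implicit.
Unset Printing Implicit Defensive.

(** * Vertex decomposability of whiskered graphs *)

Section SheddingComplexes.
Variable T : finType.
Implicit Types (D : {set {set T}}) (E F K X : {set T}) (x y : T).

Definition down_closed D := forall E F, F \in D -> E \subset F -> E \in D.

(* For a down-closed [D] the facet condition of [vertex_decomposable] says that
   no face of the link is maximal in the deletion. *)
Inductive shed_dec : {set {set T}} -> Prop :=
| shed_simplex F : shed_dec (powerset F)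
| shed_vertex D x :
    shed_dec (deletion D x) -> shed_dec (link D x) ->
    (forall F, F \in link D x -> exists2 y, y \notin F & y |: F \in deletion D x) ->
    shed_dec D.

Lemma down_closed_powerset F : down_closed (powerset F).
Proof. by move=> E E'; rewrite !inE => /[swap]; apply: subset_trans. Qed.

Lemma down_closed_deletion D x : down_closed D -> down_closed (deletion D x).
Proof.
move=> dD E F; rewrite !inE => /andP[FD xF] sEF; rewrite (dD _ _ FD sEF) /=.
by apply: contra xF; apply: (subsetP sEF).
Qed.

Lemma down_closed_link D x : down_closed D -> down_closed (link D x).
Proof.
move=> dD E F; rewrite !inE => /and3P[FD xF xFD] sEF; rewrite (dD _ _ FD sEF) /=.
rewrite (dD _ _ xFD (setUS _ sEF)) andbT.
by apply: contra xF; apply: (subsetP sEF).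
Qed.

(** A facet [G] of the link above [F] is not maximal in the deletion, so a facet [G'] of the
    deletion contains it properly; any [y] in [G'] outside [G] serves. *)
Lemma vertex_decomposable_shed_dec D :
  down_closed D -> vertex_decomposable D -> shed_dec D.
Proof.
move=> dD vD; elim: vD dD => [F _|{}D x xD _ IHd _ IHl fD dD].
  exact: shed_simplex.
apply: (@shed_vertex _ x).
- exact/IHd/down_closed_deletion.
- exact/IHl/down_closed_link.
move=> F FL; have [G /[dup] fG /maxsetP[GL _] sFG] := maxset_exists FL.
have GD : G \in deletion D x by case/setIdP: GL => GD /andP[xG _]; rewrite inE GD.
have [G' /maxsetP[G'D G'max] sGG'] := maxset_exists GD.
have neq : G != G'.
  apply: contra (fD G fG) => /eqP GG'; apply/maxsetP; split=> // B BD sB.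
  by rewrite GG' in sB *; apply: G'max.
have /properP[_ [y yG' yG]] : G \proper G' by rewrite properEneq neq.
exists y; first by apply: contra yG; apply: (subsetP sFG).
apply: (down_closed_deletion dD) G'D _.
by rewrite subUset sub1set yG' (subset_trans sFG).
Qed.

Lemma shed_dec_set0 D : shed_dec D -> set0 \in D.
Proof.
by elim=> [F|{}D x _ _ _ + _]; rewrite !inE ?sub0set // => /andP[].
Qed.

(** The simplicial join, for [D1] living on [K] and [D2] on its complement, inside a single vertex
    type. *)
Definition join K D1 D2 := [set F | (F :&: K \in D1) && (F :\: K \in D2)].

Lemma joinC K D1 D2 : join K D1 D2 = join (~: K) D2 D1.
Proof. by apply/setP=> F; rewrite inE [in RHS]inE !setDE setCK andbC. Qed.

Lemma setU1I x F K : x \in K -> (x |: F) :&: K = x |: F :&: K.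
Proof. by move=> xK; rewrite setIUl (setIidPl (_ : [set x] \subset K)) ?sub1set. Qed.

Lemma setU1D x F K : x \in K -> (x |: F) :\: K = F :\: K.
Proof.
move=> xK; rewrite setDUl (_ : [set x] :\: K = set0) ?set0U //.
by apply/eqP; rewrite setD_eq0 sub1set.
Qed.

Lemma shed_dec_join_vertex K D1 D2 x : x \in K ->
  (forall F, F \in D1 -> F \subset K) ->
  shed_dec (join K (deletion D1 x) D2) -> shed_dec (join K (link D1 x) D2) ->
  (forall F, F \in link D1 x ->
     exists2 y, y \notin F & y |: F \in deletion D1 x) ->
  shed_dec (join K D1 D2).
Proof.
move=> xK sD1 Sd Sl sh.
have eqd : deletion (join K D1 D2) x = join K (deletion D1 x) D2.
  by apply/setP=> F; rewrite !inE xK andbT andbAC.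
have eql : link (join K D1 D2) x = join K (link D1 x) D2.
  apply/setP=> F; rewrite !inE (setU1I _ xK) (setU1D _ xK) xK andbT.
  by case: (_ \in D1) (_ \in D2) (x \in F) (_ \in D1) => [] [] [] [].
apply: (@shed_vertex _ x); rewrite ?eqd ?eql // => F.
rewrite inE => /andP[FL FD2]; have [y yF yD] := sh _ FL.
have yK : y \in K.
  move: yD; rewrite inE => /andP[/sD1 + _].
  by rewrite subUset sub1set => /andP[].
exists y; first by move: yF; rewrite inE yK andbT.
by rewrite inE (setU1I _ yK) (setU1D _ yK) yD.
Qed.

(** A shedding vertex of either factor sheds the join. The induction runs over [D1] and, once that
    is a simplex, over [D2], with [joinC] exchanging the factors. *)
Lemma shed_dec_join K D1 D2 :
  (forall F, F \in D1 -> F \subset K) ->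
  (forall F, F \in D2 -> F \subset ~: K) ->
  shed_dec D1 -> shed_dec D2 -> shed_dec (join K D1 D2).
Proof.
have vK D x (L : {set T}) : (forall F, F \in D -> F \subset L) ->
    shed_dec (link D x) -> x \in L.
  move=> sD /shed_dec_set0; rewrite inE => /and3P[_ _ /sD].
  by rewrite setU0 sub1set.
move=> sD1 sD2 S1; elim: S1 sD1 => [F1 sF1 S2|{}D1 x _ IHd Sl IHl sh sD1 S2].
  have {}sF1 : F1 \subset K by apply: sF1; rewrite inE.
  elim: S2 sD2 => [F2 sF2|{}D2 x _ IHd Sl IHl sh sD2].
    have {}sF2 : F2 \subset ~: K by apply: sF2; rewrite inE.
    rewrite (_ : join _ _ _ = powerset (F1 :|: F2)); first exact: shed_simplex.
    apply/setP=> F; rewrite !inE; apply/andP/subsetP => [[/subsetP s1 /subsetP s2] y yF|s].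
      rewrite inE; have [yK|yK] := boolP (y \in K).
        by rewrite s1 // inE yF.
      by rewrite (s2 y) ?orbT // inE yK.
    split; apply/subsetP=> y; rewrite inE => /andP[].
      move=> /s + yK; rewrite inE => /orP[//|/(subsetP sF2)].
      by rewrite inE yK.
    by move=> yK /s; rewrite inE => /orP[/(subsetP sF1)|//]; rewrite (negPf yK).
  rewrite joinC; apply: (@shed_dec_join_vertex _ _ _ x) => //.
  - exact: vK Sl.
  - by rewrite -joinC; apply: IHd => F; rewrite inE => /andP[/sD2].
  - by rewrite -joinC; apply: IHl => F; rewrite inE => /andP[/sD2].
apply: (@shed_dec_join_vertex _ _ _ x) => //.
- exact: vK Sl.
- by apply: IHd => // F; rewrite inE => /andP[/sD1].
- by apply: IHl => // F; rewrite inE => /andP[/sD1].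
Qed.

End SheddingComplexes.

Lemma down_closed_imset (T T' : finType) (f : T -> T') (D : {set {set T}}) :
  injective f -> down_closed D -> down_closed [set f @: F | F : {set T} in D].
Proof.
move=> fI dD E _ /imsetP[F FD ->] sEF.
have -> : E = f @: (f @^-1: E).
  apply/setP=> y; apply/idP/imsetP => [yE|[x + ->]]; last by rewrite inE.
  by have /imsetP[x _ yx] := subsetP sEF y yE; exists x; rewrite // inE -yx.
apply/imset_f/(dD _ _ FD)/subsetP => x; rewrite inE => /(subsetP sEF).
by rewrite mem_imset.
Qed.

Lemma shed_dec_imset (T T' : finType) (f : T -> T') (D : {set {set T}}) :
  injective f -> shed_dec D -> shed_dec [set f @: F | F : {set T} in D].
Proof.
move=> fI; have fII := imset_inj fI.
have mem (E : {set {set T}}) (F : {set T}) :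
  (f @: F \in [set f @: F | F : {set T} in E]) = (F \in E) by rewrite mem_imset.
have fx (x : T) (F : {set T}) : (f x \in f @: F) = (x \in F) by rewrite mem_imset.
have fU (x : T) (F : {set T}) : f x |: f @: F = f @: (x |: F).
  by rewrite imsetU1.
elim=> [F|{}D x _ Sd _ Sl sh].
  rewrite (_ : imset _ _ = powerset (f @: F)); first exact: shed_simplex.
  apply/setP=> G; rewrite inE; apply/imsetP/idP => [[F' + ->]|sG].
    by rewrite inE; apply: imsetS.
  exists (f @^-1: G :&: F); first by rewrite inE subsetIr.
  apply/setP=> y; apply/idP/imsetP => [yG|[z + ->]].
    have /imsetP[z zF yz] := subsetP sG y yG.
    by exists z; rewrite // !inE -yz yG.
  by rewrite !inE => /andP[].
have eqd : deletion [set f @: F | F : {set T} in D] (f x) =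
    [set f @: F | F : {set T} in deletion D x].
  apply/setP=> G; rewrite inE; apply/andP/imsetP => [[/imsetP[F FD ->]]|[F + ->]].
    by rewrite fx => xF; exists F; rewrite // inE FD.
  by rewrite inE mem fx => /andP[].
have eql : link [set f @: F | F : {set T} in D] (f x) =
    [set f @: F | F : {set T} in link D x].
  apply/setP=> G; rewrite inE; apply/and3P/imsetP => [[/imsetP[F FD ->]]|[F + ->]].
    by rewrite fx fU mem => xF xD; exists F; rewrite // inE FD xF.
  by rewrite inE mem fx fU mem => /and3P[].
apply: (@shed_vertex _ _ (f x)); rewrite ?eqd ?eql // => _ /imsetP[F FL ->].
by have [y yF yD] := sh F FL; exists (f y); rewrite ?fx // fU mem.
Qed.

(** * Independence complexes of induced subgraphs *)

Section InducedIndependence.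
Variables (T : finType) (H : sgraph T).
Implicit Types (F X Y : {set T}).

(** Induced subgraphs keep the ambient vertex type, so that deletions and links at a vertex of [X]
    are again of this form. *)
Definition IndX X := [set F in Ind H | F \subset X].

Lemma in_Ind F : reflect {in F &, forall u v, ~~ H u v} (F \in Ind H).
Proof.
rewrite inE; apply: (iffP forall_inP) => [h u v uF vF|h u uF].
  by have /forall_inP := h u uF; apply.
by apply/forall_inP => v; apply: h.
Qed.

Lemma in_IndX X F : (F \in IndX X) = (F \in Ind H) && (F \subset X).
Proof. by rewrite inE. Qed.

Lemma down_closed_Ind : down_closed (Ind H).
Proof.
move=> E F /in_Ind iF /subsetP sEF; apply/in_Ind => u v uE vE.
by apply: iF; apply: sEF.
Qed.

Lemma IndX_setT : IndX setT = Ind H.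
Proof. by apply/setP=> F; rewrite inE subsetT andbT. Qed.

Lemma IndX_set0 : shed_dec (IndX set0).
Proof.
rewrite (_ : IndX set0 = powerset set0); first exact: shed_simplex.
apply/setP=> F; rewrite inE [in RHS]inE subset0; case: eqP => [->|_]; last exact: andbF.
by rewrite andbT; apply/in_Ind => u v; rewrite inE.
Qed.

Lemma in_Ind_setU1 x F :
  (x |: F \in Ind H) = (F \in Ind H) && [forall y in F, ~~ H x y].
Proof.
apply/in_Ind/andP => [h|[/in_Ind iF /forall_inP xF] u v].
  split; first by apply/in_Ind => u v uF vF; apply: h; rewrite inE ?uF ?vF orbT.
  by apply/forall_inP => y yF; apply: h; rewrite !inE ?eqxx ?yF ?orbT.
rewrite !inE => /predU1P[->|uF] /predU1P[->|vF].
- by rewrite edge_irr.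
- exact: xF.
- by rewrite edge_sym; exact: xF.
- exact: iF.
Qed.

Lemma deletion_IndX X x : deletion (IndX X) x = IndX (X :\ x).
Proof. by apply/setP=> F; rewrite !inE subsetD1 andbA. Qed.

Lemma link_IndX X x : x \in X ->
  link (IndX X) x = IndX [set y in X | (y != x) && ~~ H x y].
Proof.
move=> xX; apply/setP=> F.
rewrite [in LHS]inE !in_IndX in_Ind_setU1 subUset sub1set xX /=.
case: (boolP (F \in Ind H)) => //= iF.
apply/and3P/subsetP => [[/subsetP sFX xF /andP[/forall_inP nH _]] y yF|s].
  rewrite inE sFX //= nH // andbT.
  by apply: contraNneq xF => <-.
split.
- by apply/subsetP=> y /s; rewrite inE => /and3P[].
- by apply/negP => /s; rewrite inE eqxx andbF.
- apply/andP; split; last by apply/subsetP=> y /s; rewrite inE => /and3P[].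
  by apply/forall_inP => y /s; rewrite inE => /and3P[].
Qed.

Lemma IndX_join (K Y : {set T}) : [disjoint K & Y] ->
  {in K & Y, forall a b, ~~ H a b} -> IndX (K :|: Y) = join K (IndX K) (IndX Y).
Proof.
move=> dKY nKY; apply/setP=> F; rewrite [in RHS]inE !in_IndX subsetIr andbT.
apply/andP/and3P=> [[iF /subsetP sF]|[i1 i2 /subsetP s]].
  split.
  - by apply: (down_closed_Ind iF); exact: subsetIl.
  - by apply: (down_closed_Ind iF); exact: subsetDl.
  - by apply/subsetP=> y; rewrite inE => /andP[/negPf yK /sF]; rewrite inE yK.
have sF y : y \in F -> (y \in K) || (y \in Y).
  by move=> yF; case: (boolP (y \in K)) => //= yK; rewrite s // inE yK.
split; last by apply/subsetP=> y /sF; rewrite inE.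
apply/in_Ind => u v uF vF.
have [uK|uK] := boolP (u \in K); have [vK|vK] := boolP (v \in K).
- by move/in_Ind: i1; apply; rewrite inE ?uF ?vF.
- by apply: nKY => //; have := sF _ vF; rewrite (negPf vK).
- by rewrite edge_sym; apply: nKY => //; have := sF _ uF; rewrite (negPf uK).
- by move/in_Ind: i2; apply; rewrite inE ?uK ?vK.
Qed.

End InducedIndependence.

Lemma IndX_imset (T T' : finType) (H : sgraph T) (H' : sgraph T') (f : T' -> T) :
  injective f -> (forall u v, H (f u) (f v) = H' u v) ->
  IndX H (f @: setT) = [set f @: F | F : {set T'} in Ind H'].
Proof.
move=> fI HH; apply/setP=> F; rewrite inE; apply/andP/imsetP.
  move=> [/in_Ind iF /subsetP sF]; exists (f @^-1: F).
    by apply/in_Ind => u v; rewrite !inE -HH; apply: iF.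
  apply/setP=> y; apply/idP/imsetP => [yF|[z + ->]]; last by rewrite inE.
  by have /imsetP[z _ yz] := sF y yF; exists z; rewrite // inE -yz.
move=> [F' /in_Ind iF' ->]; split; last by apply/imsetS/subsetT.
by apply/in_Ind => _ _ /imsetP[u uF ->] /imsetP[v vF ->]; rewrite HH; apply: iF'.
Qed.

(** * Shedding the core vertices of a whiskered graph *)

Section Whiskers.
(** [S0] stands for the core vertices, the [K c] for the blocks of whiskers, and [own v] for a block
    attached to a clique containing [v]. *)
Variables (T C : finType) (H : sgraph T) (K : C -> {set T}) (own : T -> C).
Variable S0 : {set T}.
Hypothesis K_disj : forall c c', c != c' -> [disjoint K c & K c'].
Hypothesis K_sep : forall c c', c != c' -> {in K c & K c', forall a b, ~~ H a b}.
Hypothesis K_shed : forall c, shed_dec (IndX H (K c)).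
Hypothesis K_core : forall v c, v \in S0 -> v \notin K c.
Hypothesis K_unif : forall v c, v \in S0 -> {in K c &, forall a b, H v a = H v b}.
Hypothesis own_adj : forall v, v \in S0 -> exists2 a, a \in K (own v) & H v a.
Hypothesis own_dom : forall v w a, v \in S0 -> w \in S0 -> a \in K (own v) ->
  H w a -> w = v \/ H v w.

(** Blocks are split off one at a time; without edges in between, the complex is a join. *)
Lemma shed_dec_disjoint_union (Q : {set C}) :
  shed_dec (IndX H (\bigcup_(c in Q) K c)).
Proof.
elim: {Q}_.+1 {-2}Q (ltnSn #|Q|) => // m IH Q ltQm.
have [->|/set0Pn[c cQ]] := eqVneq Q set0.
  by rewrite big_set0; apply: IndX_set0.
move: ltQm; rewrite (cardsD1 c) cQ => /IH {}IH.
rewrite -(setD1K cQ).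
have {cQ} : c \notin Q :\ c by rewrite !inE eqxx.
move: (Q :\ c) IH => {}Q IH cQ.
rewrite big_setU1 //= IndX_join.
- apply: shed_dec_join => //.
  + by move=> F; rewrite inE => /andP[].
  + move=> F; rewrite inE => /andP[_] /subset_trans; apply.
    apply/bigcupsP => c' c'Q; rewrite -disjoints_subset disjoint_sym K_disj //.
    by apply: contraNneq cQ => ->.
- apply: bigcup_disjoint => c' c'Q; apply: K_disj.
  by apply: contraNneq cQ => ->.
- move=> a b aK /bigcupP[c' c'Q bK]; apply: K_sep aK bK.
  by apply: contraNneq cQ => ->.
Qed.

(* A whisker vertex [a] attached to [v] is dominated by [v], so that [v] can be
   shed; afterwards every own whisker of a remaining vertex is still present. *)
Lemma shed_dec_whiskers (S : {set T}) (Q : {set C}) : S \subset S0 ->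
  (forall v, v \in S -> own v \in Q) ->
  shed_dec (IndX H (S :|: \bigcup_(c in Q) K c)).
Proof.
(* [Q] stays general, since passing to a link discards blocks of whiskers. *)
elim: {S}_.+1 {-2}S (ltnSn #|S|) Q => // m IH S ltSm Q sS ownQ.
have [->|/set0Pn[v vS]] := eqVneq S set0.
  by rewrite set0U; apply: shed_dec_disjoint_union.
have vS0 := subsetP sS v vS.
set X := S :|: _.
have vX : v \in X by rewrite inE vS.
have lt (S' : {set T}) : S' \subset S :\ v -> #|S'| < m.
  move=> /subset_leq_card /leq_ltn_trans; apply.
  by move: ltSm; rewrite (cardsD1 v) vS.
(* By [K_unif], [v] is adjacent to all or none of a block, so the link retains exactly the blocks in
   [Q'], each as a whole. *)
pose Q' := [set c in Q | [forall a in K c, ~~ H v a]].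
pose S' := [set w in S | (w != v) && ~~ H v w].
have eqd : X :\ v = (S :\ v) :|: \bigcup_(c in Q) K c.
  apply/setP=> w; rewrite !inE; case: eqP => //= ->; symmetry; apply/negbTE.
  by apply/bigcupP => -[c _]; rewrite (negPf (K_core c vS0)).
have eql : [set y in X | (y != v) && ~~ H v y] = S' :|: \bigcup_(c in Q') K c.
  apply/setP=> w; rewrite !inE; have [wS|wS] /= := boolP (w \in S).
    case: (boolP (_ && _)) => //= nw; symmetry; apply/negbTE.
    apply: contra nw => /bigcupP[c _ wK].
    by have := K_core c (subsetP sS _ wS); rewrite wK.
  apply/andP/bigcupP => [[/bigcupP[c cQ wK] /andP[_ nvw]]|[c]].
    exists c => //; rewrite inE cQ /=; apply/forall_inP => a aK.
    by rewrite (K_unif vS0 aK wK).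
  rewrite inE => /andP[cQ /forall_inP nH] wK; split; first by apply/bigcupP; exists c.
  by rewrite nH // andbT; apply: contraNneq (K_core c vS0) => <-.
have S'S : S' \subset S :\ v.
  by apply/subsetP=> w; rewrite !inE => /and3P[-> ->].
have ownQ' w : w \in S' -> own w \in Q'.
  rewrite !inE => /and3P[wS nwv nvw]; rewrite ownQ //=; apply/forall_inP => a aK.
  have wS0 := subsetP sS w wS.
  apply/negP => /(own_dom wS0 vS0 aK)[vw|]; first by rewrite vw eqxx in nwv.
  by rewrite edge_sym (negPf nvw).
apply: (@shed_vertex _ _ v).
- rewrite deletion_IndX eqd; apply: IH; first exact: lt.
  + by rewrite (subset_trans _ sS) // subD1set.
  + by move=> w; rewrite inE => /andP[_ /ownQ].
- rewrite link_IndX // eql; apply: IH => //; first exact: lt.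
  by rewrite (subset_trans S'S) // (subset_trans _ sS) // subD1set.
move=> F; rewrite link_IndX // eql inE => /andP[iF /subsetP sF].
have [a aK va] := own_adj vS0.
have aQ' : own v \notin Q'.
  rewrite inE negb_and; apply/orP; right; apply/negP => /forall_inP /(_ a aK).
  by rewrite va.
have naS w : w \in S -> w != a.
  by move=> wS; apply: contraTneq aK => <-; apply: K_core; apply: (subsetP sS).
(* The whisker [a] extends every face of the link: its core neighbours are [v] or adjacent to [v],
   and its own block has left the link. *)
have nawH w : w \in F -> (w != a) && ~~ H a w.
  move=> /sF; rewrite inE => /orP[wS'|/bigcupP[c cQ' wK]].
    move: (wS'); rewrite inE => /and3P[wS nwv nvw]; rewrite naS //=.
    rewrite edge_sym; apply/negP => /(own_dom vS0 (subsetP sS w wS) aK)[wv|].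
      by rewrite wv eqxx in nwv.
    by rewrite (negPf nvw).
  have nc : own v != c by apply: contraNneq aQ' => ->.
  rewrite (K_sep nc) // andbT; apply: contraTneq wK => ->.
  by have /disjointFr -> := K_disj nc.
exists a; first by apply/negP => /nawH; rewrite eqxx.
rewrite deletion_IndX inE in_Ind_setU1 iF eqd /=; apply/andP; split.
  by apply/forall_inP => w /nawH /andP[].
rewrite subUset sub1set inE; apply/andP; split.
  by apply/orP; right; apply/bigcupP; exists (own v); rewrite ?ownQ.
apply/subsetP=> w /sF; rewrite !inE => /orP[/and3P[-> -> _]//|/bigcupP[c cQ' wK]].
apply/orP; right; apply/bigcupP; exists c => //.
by move: cQ'; rewrite inE => /andP[].
Qed.

End Whiskers.

(** The blocks are the [A i] and the [B j], and a core vertex owns the [A i] of its clique [W i].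
    The core neighbours of these whiskers form that clique, whence the domination. *)
Lemma shed_dec_md_graph (V : finType) (G : sgraph V)
    (d s r : nat) (W : 'I_d -> {set V}) (U : 'I_s -> {set V})
    (r_le_s : r <= s)
    (A : 'I_d -> finType) (B : 'I_r -> finType)
    (GA : forall i, sgraph (A i)) (GB : forall j, sgraph (B j)) :
  clique_partition G W -> (forall i, 0 < #|A i|) ->
  (forall i, vd_graph (GA i)) -> (forall j, vd_graph (GB j)) ->
  shed_dec (Ind (md_graph G W U r_le_s GA GB)).
Proof.
move=> [[_ /and3P[/eqP Wcov _ _]] Wcl] A0 GAvd GBvd.
set H := md_graph _ _ _ _ _ _.
have Wex u : exists i, u \in W i.
  have : u \in cover [set W i | i : 'I_d] by rewrite Wcov.
  by rewrite cover_imset => /bigcupP[i _ uW]; exists i.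
pose C := ('I_d + 'I_r)%type.
pose index (x : md_vertex V A B) : option C := match x with
  | inl _ => None | inr (inl a) => Some (inl (tag a)) | inr (inr b) => Some (inr (tag b)) end.
(* The values at whiskers are defaults; the hypotheses on [own] concern core vertices. *)
pose own (x : md_vertex V A B) : C := match x with
  | inl u => inl (xchoose (Wex u))
  | inr (inl a) => inl (tag a) | inr (inr b) => inr (tag b) end.
pose K (c : C) := [set x | index x == Some c].
pose S0 : {set md_vertex V A B} := [set x | if x is inl _ then true else false].
have ownP (u v : V) : (v \in W (xchoose (Wex u))) -> v = u \/ G u v.
  move=> vW; have [->|neq] := eqVneq v u; [by left|right].
  by apply: (Wcl _ _ _ (xchooseP (Wex u)) vW); rewrite eq_sym.
have shed (I : finType) (E : I -> finType) (GE : forall i, sgraph (E i)) i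
    (f : {i : I & E i} -> md_vertex V A B) : injective f ->
    (forall a b, H (f a) (f b) = tagged_edge GE a b) -> vd_graph (GE i) ->
    shed_dec (IndX H [set f (Tagged E a) | a in [set: E i]]).
  move=> fI HfE vdE; rewrite (IndX_imset (H' := GE i)).
  - apply: shed_dec_imset; first by move=> a b /fI; apply: eq_from_Tagged.
    apply: vertex_decomposable_shed_dec vdE; exact: down_closed_Ind.
  - by move=> a b /fI; apply: eq_from_Tagged.
  - by move=> a b; rewrite HfE /tagged_edge /= eqxx tagged_asE.
have := @shed_dec_whiskers _ C H K own S0 _ _ _ _ _ _ _ S0 setT (subxx _).
rewrite (_ : S0 :|: _ = setT) ?IndX_setT; last first.
  apply/setP=> x; rewrite !inE; case: x => [u|y] //=.
  apply/bigcupP; case: y => [a|b]; [exists (inl (tag a))|exists (inr (tag b))];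
    by rewrite inE ?eqxx.
apply => //.
- move=> c c' neq; rewrite -setI_eq0; apply/eqP/setP=> x; rewrite !inE.
  apply/negP=> /andP[/eqP -> /eqP[cc']]; by rewrite cc' eqxx in neq.
- move=> c c' neq x y; rewrite !inE => /eqP xc /eqP yc; apply: contraNN neq.
  case: x xc => [//|[a|b]] [<-]; case: y yc => [//|[a'|b']] [<-] //= /andP[/eqP tt' _];
    by rewrite tt'.
- case=> [i|j].
  + rewrite (_ : K _ = [set (inr (inl (Tagged A a))) | a in [set: A i]]); last first.
      apply/setP=> x; rewrite inE; apply/eqP/imsetP => [|[a _ ->//]].
      case: x => [//|[[i' a]|//]] /= [ii']; rewrite -ii'; by exists a.
    by apply: (shed _ _ GA i (fun a => inr (inl a))) => // a b [].
  + rewrite (_ : K _ = [set (inr (inr (Tagged B a))) | a in [set: B j]]); last first.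
      apply/setP=> x; rewrite inE; apply/eqP/imsetP => [|[a _ ->//]].
      case: x => [//|[//|[i' a]]] /= [ii']; rewrite -ii'; by exists a.
    by apply: (shed _ _ GB j (fun a => inr (inr a))) => // a b [].
- by case=> [u|[a|b]] c; rewrite !inE.
- case=> [u|[a|b]] c; rewrite ?inE // => _.
  by case=> [?|[a|b]] [?|[a'|b']]; rewrite !inE // => /eqP[<-] /eqP[] //= ->.
- case=> [u|[a|b]]; rewrite ?inE // => _.
  have /card_gt0P[a _] := A0 (xchoose (Wex u)).
  exists (inr (inl (Tagged A a))); rewrite ?inE //=.
  exact: xchooseP (Wex u).
- case=> [u|[a|b]] [v|[a'|b']] [w|[a''|b'']]; rewrite ?inE // => _ _ /eqP[] //= ->.
  by case/ownP => [->|]; [left|right].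
Qed.

(** * Shellings by decreasing dimension *)

Section Shellings.
Variable T : finType.
Implicit Types (D L : {set {set T}}) (E F R : {set T}) (x : T) (e : nat).

Definition face_interval R F := [set E : {set T} | (R \subset E) && (E \subset F)].

(** [R] is the least new face. For down-closed [D'], the condition on [R] makes the whole interval
    new, and down-closure of the union puts the faces of [F] not containing [R] into [D']. *)
Inductive shells e D : {set {set T}} -> Prop :=
| shells_refl : shells e D D
| shells_step D' R F :
    shells e D D' -> R \subset F -> #|F| = e -> R \notin D' ->
    down_closed (D' :|: face_interval R F) -> shells e D (D' :|: face_interval R F).

(** This is [D(e)]. It is void, without even the empty face, if no face has at least [e]
    vertices. *)
Definition pure_part e D :=
  [set E in D | [exists F in D, (E \subset F) && (e <= #|F|)]].

(* The complex with deletion [D] and link [L] at [x]. *)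
Definition glue x D L :=
  [set E : {set T} | if x \in E then E :\ x \in L else E \in D].

Lemma shells_trans e D1 D2 D3 : shells e D1 D2 -> shells e D2 D3 -> shells e D1 D3.
Proof. by move=> S12; elim=> // *; apply: shells_step. Qed.

Lemma shells_subset e D D' : shells e D D' -> D \subset D'.
Proof. by elim=> // {}D' R F _ sDD' _ _ _ _; rewrite subsetU // sDD'. Qed.

Lemma shells_down_closed e D D' : down_closed D -> shells e D D' -> down_closed D'.
Proof. by move=> dD; case. Qed.

Lemma shells_card e D D' E : shells e D D' -> E \in D' -> E \notin D -> #|E| <= e.
Proof.
elim=> [->//|{}D' R F _ IH _ cF _ _]; rewrite !inE => /orP[/IH//|/andP[_ sEF] _].
by rewrite -cF subset_leq_card.
Qed.

Lemma down_closed_pure_part e D : down_closed D -> down_closed (pure_part e D).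
Proof.
move=> dD E F; rewrite !inE => /andP[FD /existsP[G /and3P[GD sFG eG]]] sEF.
by rewrite (dD _ _ FD sEF); apply/existsP; exists G; rewrite GD eG (subset_trans sEF).
Qed.

Lemma in_pure_part e D E F :
  down_closed D -> F \in D -> E \subset F -> e <= #|F| -> E \in pure_part e D.
Proof.
move=> dD FD sEF eF; rewrite inE (dD _ _ FD sEF).
by apply/existsP; exists F; rewrite FD sEF.
Qed.

Lemma pure_partP e D E :
  reflect (exists F, [/\ F \in D, E \subset F & e <= #|F|] /\ E \in D)
          (E \in pure_part e D).
Proof.
rewrite inE; apply: (iffP andP) => [[ED /existsP[F /and3P[FD sEF eF]]]|[F [[FD sEF eF] ED]]].
  by exists F.
by split=> //; apply/existsP; exists F; rewrite FD sEF.
Qed.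

Lemma down_closed_glue x D L :
  down_closed D -> down_closed L -> L \subset D -> down_closed (glue x D L).
Proof.
move=> dD dL /subsetP sLD E F; rewrite !inE => FG sEF.
case: ifPn => xE.
  by rewrite (subsetP sEF _ xE) in FG; apply: dL FG _; apply: setSD.
case: ifPn FG => xF FD; last exact: dD FD sEF.
by apply: dD (sLD _ FD) _; rewrite subsetD1 sEF.
Qed.

Lemma glue_intervalD x D L R F : x \notin F ->
  glue x (D :|: face_interval R F) L = glue x D L :|: face_interval R F.
Proof.
move=> xF; apply/setP=> E; rewrite !inE; case: ifPn => // xE.
suff -> : (E \subset F) = false by rewrite andbF orbF.
by apply: contraNF xF => /subsetP; apply.
Qed.

Lemma glue_intervalL x D L R F : x \notin R -> x \notin F ->
  glue x D (L :|: face_interval R F) = glue x D L :|: face_interval (x |: R) (x |: F).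
Proof.
move=> xR xF; apply/setP=> E; rewrite !inE subUset sub1set subDset.
rewrite subsetD1 xR andbT.
by case: ifPn => // xE; rewrite orbF.
Qed.

(** The intervals attached to the deletion avoid [x] and serve unchanged; [L] being inside [D] keeps
    the glued complexes down-closed. *)
Lemma shells_glueD e x D D' L :
  (forall E, E \in D' -> x \notin E) -> down_closed D -> down_closed L ->
  L \subset D -> shells e D D' -> shells e (glue x D L) (glue x D' L).
Proof.
move=> xD' dD dL sLD S; elim: S xD' => [*|{}D' R F S IH sRF cF RD' dD'' xD''].
  exact: shells_refl.
have FD : F \in D' :|: face_interval R F by rewrite !inE sRF subxx orbT.
have xF := xD'' _ FD.
have xR : x \notin R by apply: contra xF; apply: (subsetP sRF).
have dg := @down_closed_glue x _ _ dD'' dL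
  (subset_trans sLD (subset_trans (shells_subset S) (subsetUl _ _))).
rewrite glue_intervalD // in dg *; apply: shells_step => //.
- by apply: IH => E ED; apply: xD''; rewrite inE ED.
- by rewrite inE (negPf xR).
Qed.

(** Every interval of the link gains [x] at both ends, which raises the facet size by one. *)
Lemma shells_glueL e x D L L' :
  (forall E, E \in L' -> x \notin E) -> down_closed D -> down_closed L ->
  L' \subset D -> shells e L L' -> shells e.+1 (glue x D L) (glue x D L').
Proof.
move=> xL' dD dL sLD S; elim: S xL' sLD => [*|{}L' R F S IH sRF cF RL' dL'' xL'' sL''D].
  exact: shells_refl.
have FL : F \in L' :|: face_interval R F by rewrite !inE sRF subxx orbT.
have xF := xL'' _ FL.
have xR : x \notin R by apply: contra xF; apply: (subsetP sRF).
have dg := @down_closed_glue x _ _ dD dL'' sL''D.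
rewrite glue_intervalL // in dg *; apply: shells_step => //.
- apply: IH => [E EL|]; first by apply: xL''; rewrite inE EL.
  exact: subset_trans (subsetUl _ _) sL''D.
- exact: setUS.
- by rewrite cardsU1 xF cF.
- by rewrite inE setU11 setU1K.
Qed.

Section Shed.
Variables (D : {set {set T}}) (x : T).
Hypothesis dD : down_closed D.
Hypothesis shed : forall F, F \in link D x ->
  exists2 y, y \notin F & y |: F \in deletion D x.

(** A shedding witness enlarges a face of the link to a face of the deletion with one more
    vertex. *)
Lemma pure_part_link_sub e : pure_part e (link D x) \subset pure_part e.+1 (deletion D x).
Proof.
apply/subsetP=> E /pure_partP[F [[FL sEF eF] _]].
have [y yF yD] := shed FL; apply: in_pure_part yD _ _.
- exact: down_closed_deletion.
- by rewrite (subset_trans sEF) // subsetUr.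
- by rewrite cardsU1 yF.
Qed.

Lemma pure_part_glue e :
  pure_part e.+1 D = glue x (pure_part e.+1 (deletion D x)) (pure_part e (link D x)).
Proof.
have dd := down_closed_deletion (x := x) dD; have dl := down_closed_link (x := x) dD.
apply/setP=> E; rewrite [in RHS]inE; case: ifPn => xE; apply/idP/idP.
- case/pure_partP=> F [[FD sEF eF] ED].
  have xF := subsetP sEF x xE.
  apply: (@in_pure_part _ _ _ (F :\ x)) => //; last 1 first.
  + by move: eF; rewrite (cardsD1 x) xF.
  + by rewrite !inE eqxx setD1K // FD (dD FD) // subD1set.
  + exact: setSD.
- case/pure_partP=> F [[]]; rewrite inE => /and3P[FD xF xFD] sEF eF _.
  apply: (@in_pure_part _ _ _ (x |: F)) => //; last by rewrite cardsU1 xF.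
  by rewrite -(setD1K xE) setUS.
- case/pure_partP=> F [[FD sEF eF] ED].
  have [xF|xF] := boolP (x \in F); last by apply: in_pure_part sEF eF; rewrite // inE FD.
  (* The large face above [E] contains [x]; removing [x] leaves a face of the link, which shedding
     trades for a large face avoiding [x]. *)
  apply: (subsetP (pure_part_link_sub e)).
  apply: (@in_pure_part _ _ _ (F :\ x)) => //; last 1 first.
  + by move: eF; rewrite (cardsD1 x) xF.
  + by rewrite !inE eqxx setD1K // FD (dD FD) // subD1set.
  + by rewrite subsetD1 sEF.
- case/pure_partP=> F [[]]; rewrite inE => /andP[FD _] sEF eF _.
  exact: in_pure_part sEF eF.
Qed.

End Shed.

(* Björner and Wachs: a shelling can be rearranged so that the facets come in
   order of decreasing cardinality. *)
Lemma shells_pure_part D e :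
  shed_dec D -> down_closed D -> shells e (pure_part e.+1 D) (pure_part e D).
Proof.
move=> S; elim: S e => [F e _|{}D x Sd IHd Sl IHl sh e dD].
  have mem e' E : (E \in pure_part e' (powerset F)) = (E \subset F) && (e' <= #|F|).
    apply/pure_partP/andP=> [[F' []]|[sEF eF]].
      rewrite !inE => -[sF' _ eF'] sE; split=> //.
      by apply: leq_trans eF' _; apply: subset_leq_card.
    by exists F; rewrite !inE.
  (* For a simplex [D(e)] jumps only here, from the void complex to all of it, by the single
     interval from [set0] to [F]. *)
  have [eF|neF] := eqVneq e #|F|.
    rewrite (_ : pure_part e _ = pure_part e.+1 (powerset F) :|: face_interval set0 F).
      apply: shells_step; rewrite ?sub0set ?mem ?eF ?ltnn ?andbF //.
        exact: shells_refl.
      rewrite (_ : _ :|: _ = powerset F); first exact: down_closed_powerset.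
      by apply/setP=> E; rewrite inE mem !inE ltnn andbF sub0set.
    by apply/setP=> E; rewrite [in RHS]inE !mem !inE eF leqnn ltnn andbF andbT sub0set.
  rewrite (_ : pure_part e _ = pure_part e.+1 (powerset F)).
    exact: shells_refl.
  by apply/setP=> E; rewrite !mem ltn_neqAle neF.
have dd := down_closed_deletion (x := x) dD; have dl := down_closed_link (x := x) dD.
(* Levels 0 and 1 agree, since a shedding witness for the empty face of the link is a vertex above
   the empty face. *)
case: e => [|e].
  rewrite (_ : pure_part 0 D = pure_part 1 D); first exact: shells_refl.
  apply/setP=> E; apply/idP/idP => /pure_partP[F [[FD sEF eF] ED]]; last first.
    exact: in_pure_part FD sEF _.
  have [E0|E0] := posnP #|E|; last exact: (in_pure_part dD ED (subxx _) E0).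
  have [y y0 yD] := sh _ (shed_dec_set0 Sl).
  apply: (@in_pure_part _ _ _ (y |: set0)) => //.
  - by move: yD; rewrite inE => /andP[].
  - by move/eqP: E0; rewrite cards_eq0 => /eqP->; apply: sub0set.
  - by rewrite cardsU1 y0.
rewrite !(pure_part_glue dD sh).
(* The deletion is enlarged first; only then does it contain the larger part of the link, as gluing
   demands. *)
apply: (@shells_trans _ _ (glue x (pure_part e.+1 (deletion D x)) (pure_part e.+1 (link D x)))).
  apply: shells_glueD; try exact: down_closed_pure_part.
  - by move=> E; rewrite !inE -andbA => /and3P[].
  - exact: pure_part_link_sub.
  - exact: IHd.
apply: shells_glueL; try exact: down_closed_pure_part.
- by move=> E; rewrite !inE -!andbA => /and3P[].
- exact: pure_part_link_sub.
- exact: IHl.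
Qed.

End Shellings.

(** * Stanley-Reisner ideals *)

Import GRing.Theory.
Local Open Scope ring_scope.

Lemma ideal_intro (R : comNzRingType) (I : R -> Prop) :
  I 0 -> (forall a b, I a -> I b -> I (a + b)) -> (forall a b, I b -> I (a * b)) ->
  ideal I.
Proof. by []. Qed.

Section Ideals.
Variables (R : comNzRingType) (I : R -> Prop).
Hypothesis idI : ideal I.

Lemma ideal0 : I 0. Proof. by case: idI. Qed.

Lemma idealD a b : I a -> I b -> I (a + b). Proof. by case: idI => _ + _; apply. Qed.

Lemma ideal_mull a b : I b -> I (a * b). Proof. by case: idI => _ _; apply. Qed.

Lemma ideal_mulr a b : I a -> I (a * b). Proof. by rewrite mulrC; apply: ideal_mull. Qed.

Lemma idealN a : I a -> I (- a). Proof. by rewrite -mulN1r; apply: ideal_mull. Qed.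

Lemma idealB a b : I a -> I b -> I (a - b).
Proof. by move=> Ia Ib; apply/idealD/idealN. Qed.

Lemma ideal_sum (J : Type) (s : seq J) (Q : pred J) (F : J -> R) :
  (forall j, Q j -> I (F j)) -> I (\sum_(j <- s | Q j) F j).
Proof. by apply: big_ind; [apply: ideal0|apply: idealD]. Qed.

End Ideals.

Lemma pred_ext (A : Type) (P Q : A -> Prop) : (forall a, P a <-> Q a) -> P = Q.
Proof.
by move=> PQ; apply: functional_extensionality => a; apply: propositional_extensionality.
Qed.

Section Support.
Variable n : nat.
Implicit Types (m : 'X_{1..n}) (F : {set 'I_n}).

Definition supp m : {set 'I_n} := [set i | m i != 0%N].

Lemma supp0 : supp 0%MM = set0.
Proof. by apply/setP=> i; rewrite !inE mnm0E. Qed.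

Lemma suppD m m' : supp (m + m')%MM = supp m :|: supp m'.
Proof. by apply/setP=> i; rewrite !inE mnmDE addn_eq0 negb_and. Qed.

Lemma suppU i : supp U_(i)%MM = [set i].
Proof. by apply/setP=> j; rewrite !inE mnm1E eqb0 negbK eq_sym. Qed.

Lemma supp_mesym1 F : supp (mesym1 F) = F.
Proof. by apply/setP=> i; rewrite inE mnmE eqb0 negbK. Qed.

Lemma mesym1_le F m : (mesym1 F <= m)%MM = (F \subset supp m).
Proof.
apply/mnm_lepP/subsetP => h i; last first.
  by rewrite mnmE; case: (boolP (i \in F)) => // /h; rewrite inE lt0n.
by move=> iF; have := h i; rewrite mnmE iF inE lt0n.
Qed.

Lemma mesym1_setU1 i F : i \notin F -> mesym1 (i |: F) = (U_(i) + mesym1 F)%MM.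
Proof.
move=> iF; apply/mnmP=> j; rewrite mnmDE !mnmE !inE eq_sym.
by case: eqP => [<-|]; rewrite ?(negPf iF).
Qed.

End Support.

Section StanleyReisner.
Variables (k : fieldType) (n : nat).
Local Notation S := {mpoly k[n]}.
Implicit Types (D : {set {set 'I_n}}) (F R : {set 'I_n}) (f a b u : S) (m : 'X_{1..n}).

(** For down-closed [D], the ideal spanned by the monomials whose support is not a face; reading it
    off coefficients avoids generators. The void complex gives the whole ring. *)
Definition stanley_reisner D : S -> Prop := fun f => forall m, supp m \in D -> f@_m = 0.

Definition face_prime F := stanley_reisner (powerset F).

Lemma ideal_stanley_reisner D : down_closed D -> ideal (stanley_reisner D).
Proof.
move=> dD; split=> [m _|f g If Ig m mD|a f If m mD]; first exact: mcoeff0.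
  by rewrite mcoeffD If ?Ig ?addr0.
rewrite [a *: _]/(a * f) mcoeffM big1 // => -[m1 m2] /= /eqP mE.
rewrite If ?mulr0 //; apply: dD mD _.
by have /(congr1 (@supp n)) -> := mE; rewrite suppD subsetUr.
Qed.

Lemma graded_stanley_reisner D : down_closed D -> graded_ideal (stanley_reisner D).
Proof.
move=> dD; split; first exact: ideal_stanley_reisner.
move=> f e If m mD; rewrite pihomogE raddf_sum big1 //= => m' _.
rewrite mcoeffZ mcoeffX; case: eqP => [->|_]; last by rewrite mulr0.
by rewrite If ?mul0r.
Qed.

Lemma stanley_reisner_sub D D' f :
  D \subset D' -> stanley_reisner D' f -> stanley_reisner D f.
Proof. by move=> /subsetP sDD' If m /sDD'; apply: If. Qed.

Lemma stanley_reisnerX D m : supp m \notin D -> stanley_reisner D 'X_[m].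
Proof. by move=> mD m' m'D; rewrite mcoeffX; case: eqP mD => // ->; rewrite m'D. Qed.

Lemma mcoeffMX_eq0 f m m' : ~~ (m <= m')%MM -> (f * 'X_[m])@_m' = 0.
Proof.
move=> nle; rewrite mcoeffM big1 // => -[m1 m2] /= /eqP mE.
rewrite mcoeffX; case: eqP => [mm2|_]; last by rewrite mulr0.
by case/negP: nle; have -> := mE; rewrite mm2 lem_addl.
Qed.

Lemma mpoly_splitX m0 f : exists g b, f = g + b * 'X_[m0] /\
  forall m, g@_m = if (m0 <= m)%MM then 0 else f@_m.
Proof.
pose b := \sum_(m <- msupp f | (m0 <= m)%MM) f@_m *: 'X_[(m - m0)].
exists (f - b * 'X_[m0]), b; split; first by rewrite subrK.
move=> m; rewrite mcoeffB; case: ifP => [le|/negbT/mcoeffMX_eq0->]; last by rewrite subr0.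
have bE : b * 'X_[m0] = \sum_(m <- msupp f | (m0 <= m)%MM) f@_m *: 'X_[m].
  rewrite mulr_suml; apply: eq_bigr => m' le'.
  by rewrite -scalerAl -mpolyXD submK.
rewrite -mcoeffB bE {1}(mpolyE f) (bigID (fun m => (m0 <= m)%MM)) /=.
rewrite addrAC subrr add0r raddf_sum big1 //= => m' nle; rewrite mcoeffZ mcoeffX.
by case: eqP nle => [->|_]; rewrite ?le ?mulr0.
Qed.

Lemma face_prime_coef F f : face_prime F f <-> forall m, supp m \subset F -> f@_m = 0.
Proof. by split=> h m mF; apply: h; rewrite inE in mF *. Qed.

(** The endomorphism killing the variables outside [F]. Its kernel is [face_prime F], which is prime
    because the ring is a domain. *)
Definition restrict F f := f \mPo [tuple (if i \in F then 'X_i else 0 : S) | i < n].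

Lemma restrictM F : {morph restrict F : a b / a * b}.
Proof. by move=> a b; rewrite /restrict rmorphM. Qed.

Lemma restrictX F m : restrict F 'X_[m] = if supp m \subset F then 'X_[m] else 0.
Proof.
rewrite /restrict comp_mpolyX; case: ifPn => [/subsetP sF|/subsetPn[i im iF]].
  rewrite mpolyXE_id; apply: eq_bigr => i _; rewrite tnth_mktuple.
  have [iF|iF] := boolP (i \in F); first by [].
  by have := contra (sF i) iF; rewrite inE negbK => /eqP->; rewrite !expr0.
rewrite (bigD1 i) //= tnth_mktuple (negPf iF) expr0n.
by move: im; rewrite inE => /negPf->; rewrite mul0r.
Qed.

Lemma mcoeff_restrict F f m : (restrict F f)@_m = if supp m \subset F then f@_m else 0.
Proof.
rewrite /restrict comp_mpolyEX raddf_sum /=.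
transitivity (\sum_(m' <- msupp f) f@_m' * ((m' == m) && (supp m \subset F))%:R).
  apply: eq_bigr => m' _; rewrite mcoeffZ -/(restrict _ _) restrictX.
  case: ifPn => sF; last first.
    by rewrite mcoeff0; case: eqP sF => [->|] //= /negPf->.
  by rewrite mcoeffX; case: eqP sF => [->|] //= ->.
case: ifP => sF; last by rewrite big1 // => m' _; rewrite andbF mulr0.
rewrite {3}(mpolyE f) raddf_sum /=; apply: eq_bigr => m' _.
by rewrite andbT mcoeffZ mcoeffX.
Qed.

Lemma face_primeP F f : face_prime F f <-> restrict F f = 0.
Proof.
rewrite face_prime_coef; split=> [h|h m mF].
  by apply/mpolyP=> m; rewrite mcoeff_restrict mcoeff0; case: ifP => // /h.
by have := congr1 (mcoeff m) h; rewrite mcoeff_restrict mF mcoeff0.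
Qed.

Lemma prime_face_prime F : prime_ideal (face_prime F).
Proof.
split.
- exact/ideal_stanley_reisner/down_closed_powerset.
- move/face_prime_coef/(_ 0%MM); rewrite supp0 sub0set mcoeff1 eqxx => /(_ isT)/eqP.
  by rewrite oner_eq0.
- move=> a b /face_primeP; rewrite restrictM => /eqP; rewrite mulf_eq0.
  by case/orP => /eqP ?; [left|right]; apply/face_primeP.
Qed.

Lemma face_primeX F m : face_prime F 'X_[m] <-> ~~ (supp m \subset F).
Proof.
rewrite face_prime_coef; split=> [h|mF m' m'F].
  apply/negP => /h; rewrite mcoeffX eqxx => /eqP; by rewrite oner_eq0.
by rewrite mcoeffX; case: eqP mF => // ->; rewrite m'F.
Qed.

Lemma face_primeD1 F i a : i \in F ->
  face_prime (F :\ i) a <-> exists p b, face_prime F p /\ a = p + b * 'X_i.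
Proof.
move=> iF; split; last first.
  move=> [p [b [Fp ->]]]; have [id _ _] := prime_face_prime (F :\ i).
  apply: (idealD id).
    by apply: stanley_reisner_sub Fp; rewrite powersetS subD1set.
  by apply: (ideal_mull id); apply/face_primeX; rewrite suppU sub1set !inE eqxx.
move=> /face_prime_coef Fa; have [g [b [aE gE]]] := mpoly_splitX U_(i)%MM a.
exists g, b; split=> //; apply/face_prime_coef => m mF; rewrite gE.
case: ifPn => // le; apply: Fa; rewrite subsetD1 mF /=.
apply: contra le => im; rewrite inE in im; apply/mnm_lepP => j.
by rewrite mnm1E; case: eqP => // <-; rewrite lt0n.
Qed.

(** Every other squarefree monomial of degree [#|F|] involves a variable outside [F]. *)
Lemma face_prime_mesym F : face_prime F (mesym n k #|F| - 'X_[mesym1 F]).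
Proof.
have [id _ _] := prime_face_prime F.
rewrite mesymE (bigD1 F) //= addrAC subrr add0r; apply: (ideal_sum id) => E /andP[/eqP cE neq].
apply/face_primeX; rewrite supp_mesym1; apply: contra neq => sEF.
by rewrite eqEcard sEF cE leqnn.
Qed.

End StanleyReisner.

(** * Filtrations with face prime factors *)

Section CleanFiltrations.
Variables (k : fieldType) (n : nat).
Local Notation S := {mpoly k[n]}.
Local Notation X E := ('X_[mesym1 E] : S).
Local Notation theta e := (mesym n k e : S).
Local Notation add_mul := (@add_mul S S^o).
Implicit Types (N : S -> Prop) (E F : {set 'I_n}) (a b u x y z : S) (e : nat).

Definition adjoin N u : S -> Prop := fun x => exists y a, N y /\ x = y + a * u.

(* The factor [adjoin N0 u / N0] is isomorphic to [S / face_prime F]. *)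
Inductive clean e : (S -> Prop) -> (S -> Prop) -> Prop :=
| clean_refl N : clean e N N
| clean_step N0 N u F :
    #|F| = e -> (forall a, N0 (a * u) <-> face_prime F a) ->
    clean e (adjoin N0 u) N -> clean e N0 N.

Lemma ideal_adjoin N u : ideal N -> ideal (adjoin N u).
Proof.
move=> id; apply: ideal_intro => [|_ _ [y [a [Ny ->]]] [z [b [Nz ->]]]|c _ [y [a [Ny ->]]]].
- by exists 0, 0; split; [exact: ideal0|rewrite mul0r addr0].
- by exists (y + z), (a + b); split; [exact: (idealD id)|ring].
- exists (c * y), (c * a); split; first exact: (ideal_mull id).
  by ring.
Qed.

Lemma adjoin_sub N u x : N x -> adjoin N u x.
Proof. by exists x, 0; rewrite mul0r addr0. Qed.

Lemma adjoin_gen N u a : ideal N -> adjoin N u (a * u).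
Proof. by exists 0, a; split; [exact: ideal0|rewrite add0r]. Qed.

Lemma adjoin_adjoin N u a : ideal N -> adjoin (adjoin N (a * u)) u = adjoin N u.
Proof.
move=> id; apply: pred_ext => x; split=> [[_ [b [[y [c [Ny ->]]] ->]]]|[y [b [Ny ->]]]].
  by exists y, (c * a + b); split=> //; ring.
by exists y, b; split=> //; apply: adjoin_sub.
Qed.

Lemma adjoin_id N u : ideal N -> N u -> adjoin N u = N.
Proof.
move=> id Nu; apply: pred_ext => x; split=> [[y [a [Ny ->]]]|]; last exact: adjoin_sub.
by apply: (idealD id) => //; apply: (ideal_mull id).
Qed.

Lemma clean_sub e N0 N x : clean e N0 N -> N0 x -> N x.
Proof. by elim=> // {}N0 {}N u F _ _ _ IH N0x; apply/IH/adjoin_sub. Qed.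

Lemma add_mulE N N0 f :
  add_mul N N0 f = fun x : S => exists v w : S, [/\ N v, N0 w & x = w + f * v].
Proof. by []. Qed.

Lemma ideal_add_mul N N0 f : ideal N -> ideal N0 -> ideal (add_mul N N0 f).
Proof.
move=> idN id0; rewrite add_mulE; apply: ideal_intro.
- by exists 0, 0; split; [exact: ideal0 idN|exact: ideal0 id0|rewrite mulr0 addr0].
- move=> _ _ [y [a [Ny Na ->]]] [z [b [Nz Nb ->]]]; exists (y + z), (a + b).
  by split; [exact: (idealD idN)|exact: (idealD id0)|rewrite mulrDr addrACA].
- move=> c _ [y [a [Ny Na ->]]]; exists (c * y), (c * a).
  by split; [exact: (ideal_mull idN)|exact: (ideal_mull id0)|ring].
Qed.

Lemma face_prime_mesymP F e : #|F| = e ->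
  ~ face_prime F (theta e).
Proof.
move=> cF h; have [id _ _] := prime_face_prime k F.
have := idealB id h (@face_prime_mesym k n F); rewrite cF opprB addrC subrK.
by move/face_primeX; rewrite supp_mesym1 subxx.
Qed.

(** On each factor [theta e] acts as the product of the variables in [F], which is nonzero modulo
    the prime; regularity then passes up the filtration. *)
Lemma clean_regular e N0 N x :
  ideal N0 -> clean e N0 N -> N x -> N0 (theta e * x) -> N0 x.
Proof.
move=> id cl; elim: cl id => // {}N0 {}N u F cF colon _ IH id Nx N0x.
have [y [a [N0y xE]]] := IH (ideal_adjoin u id) Nx (adjoin_sub u N0x).
have /colon Pa : N0 (theta e * a * u).
  have -> : theta e * a * u = theta e * x - theta e * y by rewrite xE; ring.
  by apply: (idealB id) => //; apply: (ideal_mull id).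
have [_ _ /(_ _ _ Pa)[/(face_prime_mesymP cF)//|/colon]] := prime_face_prime k F.
by rewrite xE; apply: (idealD id).
Qed.

Lemma mesym1_setD E F : E \subset F -> mesym1 F = (mesym1 (F :\: E) + mesym1 E)%MM.
Proof.
move=> /subsetP sEF; apply/mnmP=> i; rewrite mnmDE !mnmE inE.
by have [/sEF->|] := boolP (i \in E); rewrite ?addn0.
Qed.

(** * One factor of a clean filtration, modulo [theta e] *)

Section Step.
Variables (e : nat) (N0 N : S -> Prop) (u : S) (F : {set 'I_n}).
Hypothesis (idN0 : ideal N0) (idN : ideal N) (Nu : N u) (cF : #|F| = e).
Hypothesis colon : forall a, N0 (a * u) <-> face_prime F a.
Hypothesis regular : forall x, N x -> adjoin N0 u (theta e * x) -> adjoin N0 u x.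

Let M := add_mul N N0 (theta e).

(** Modulo [face_prime F], [theta e] is [X F], a multiple of [X (v |: E)]. So, after cancelling
    [X E], the only relation added to [face_prime F] is the variable of [v]. *)
Lemma colon_setU1 E v a : v \in F -> v \notin E -> E \subset F ->
  adjoin M (X (v |: E) * u) (a * (X E * u)) <-> face_prime (F :\ v) a.
Proof.
move=> vF vE sEF; have [idP _ primeP] := prime_face_prime k F.
have XU : X (v |: E) = 'X_v * X E by rewrite mesym1_setU1 // mpolyXD.
rewrite (face_primeD1 a vF) /M add_mulE; split.
  move=> [_ [b [[z [w [Nz N0w ->]]] aE]]].
  have zE : theta e * z = - w + (a * X E - b * X (v |: E)) * u.
    have -> : theta e * z = (w + theta e * z + b * (X (v |: E) * u)) - w
       - b * (X (v |: E) * u) by ring.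
    by rewrite -aE; ring.
  (* Regularity puts [z] into [adjoin N0 u], which leaves a relation between multiples of [u] modulo
     [N0]. *)
  have [|y [c [N0y zE']]] := regular Nz.
    by rewrite zE; eexists _, _; split; [apply: (idealN idN0) N0w|].
  have sE'F : v |: E \subset F by rewrite subUset sub1set vF.
  pose d := X (F :\: (v |: E)).
  have XF : X F = d * 'X_v * X E by rewrite (mesym1_setD sE'F) mpolyXD XU mulrA.
  have /colon h : N0 ((a * X E - b * X (v |: E) - theta e * c) * u).
    have -> : (a * X E - b * X (v |: E) - theta e * c) * u = w + theta e * y.
      have -> : theta e * y = theta e * z - theta e * c * u by rewrite zE'; ring.
      by rewrite zE; ring.
    by apply: (idealD idN0) => //; apply: (ideal_mull idN0).
  (* Replacing [theta e] by [X F] lets [X E] be factored out; primality then cancels it. *)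
  have {}h : face_prime F (X E * (a - (b + c * d) * 'X_v)).
    have -> : X E * (a - (b + c * d) * 'X_v) =
      (a * X E - b * X (v |: E) - theta e * c) + c * (theta e - X F).
      by rewrite XU XF; ring.
    apply: (idealD idP) => //; apply: (ideal_mull idP).
    by rewrite -cF; apply: face_prime_mesym.
  case: (primeP _ _ h) => [/face_primeX|{}h]; first by rewrite supp_mesym1 sEF.
  by exists (a - (b + c * d) * 'X_v), (b + c * d); rewrite subrK.
move=> [p [b [/colon Pp ->]]]; exists (X E * (p * u)), b; split; last by rewrite XU; ring.
exists 0, (X E * (p * u)).
by split; [exact: ideal0 idN|exact: (ideal_mull idN0)|rewrite mulr0 addr0].
Qed.

(** [X F - theta e] kills [u] modulo [N0]. Hence the chain of the [X E * u] starts at [M] itself. *)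
Lemma theta_gen : M (X F * u).
Proof.
rewrite /M add_mulE; exists u, ((X F - theta e) * u); split=> //; last by ring.
have [idP _ _] := prime_face_prime k F; apply/colon; rewrite -opprB -cF.
by apply: (idealN idP); apply: face_prime_mesym.
Qed.

End Step.

Lemma add_mul_adjoin N N0 f u : add_mul N (adjoin N0 u) f = adjoin (add_mul N N0 f) u.
Proof.
rewrite !add_mulE; apply: pred_ext => x; split.
  move=> [v [_ [Nv [y [a [N0y ->]]] ->]]]; exists (y + f * v), a; split.
    by exists v, y.
  by ring.
move=> [_ [a [[v [w [Nv N0w ->]]] ->]]]; exists v, (w + a * u); split=> //.
  by exists w, a.
by ring.
Qed.

(* Each factor, generated by [u], is refined by adjoining [X E * u] for [E]
   decreasing from [F] to the empty set. *)
Lemma clean_quotient e N0 N : ideal N0 -> ideal N ->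
  clean e.+1 N0 N -> clean e (add_mul N N0 (theta e.+1)) N.
Proof.
move=> id0 idN cl; elim: cl id0 idN => {N0 N} [N id _|N0 N u F cF colon cl IH id0 idN].
  rewrite (_ : add_mul _ _ _ = N); first exact: clean_refl.
  rewrite add_mulE; apply: pred_ext => x; split=> [[y [z [Ny Nz ->]]]|Nx].
    by apply: (idealD id) => //; apply: (ideal_mull id).
  by exists 0, x; split; [exact: (ideal0 id)| |rewrite mulr0 addr0].
have Nu : N u.
  by rewrite -[u]mul1r; apply: (clean_sub cl); apply: adjoin_gen.
have id1 := ideal_adjoin u id0.
have reg x := clean_regular (x := x) id1 cl.
have idM := ideal_add_mul (theta e.+1) idN id0.
have {}IH := IH id1 idN; rewrite add_mul_adjoin in IH.
set M := add_mul _ _ _ in IH idM *.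
(* For empty [E] this is the induction hypothesis; at [E = F] nothing is adjoined, by
   [theta_gen]. *)
have chain j E : #|E| = j -> E \subset F -> clean e (adjoin M (X E * u)) N.
  elim: j E => [|j IHj] E cE sEF.
    by move/eqP: cE; rewrite cards_eq0 => /eqP->; rewrite mesym1_set0 mpolyX0 mul1r.
  have /set0Pn[v vE] : E != set0 by rewrite -cards_eq0 cE.
  have vF := subsetP sEF v vE.
  apply: (@clean_step _ _ _ (X (E :\ v) * u) (F :\ v)).
  - by apply/eqP; rewrite -eqSS -cF (cardsD1 v F) vF.
  - move=> a; rewrite -{1}(setD1K vE); apply: colon_setU1 => //.
    + by rewrite !inE eqxx.
    + by rewrite (subset_trans _ sEF) // subD1set.
  rewrite -{1}(setD1K vE) mesym1_setU1 ?inE ?eqxx // mpolyXD -mulrA.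
  rewrite adjoin_adjoin //; apply: IHj; last by rewrite (subset_trans _ sEF) // subD1set.
  by apply/eqP; rewrite -eqSS -cE (cardsD1 v E) vE.
have := chain _ F erefl (subxx _); rewrite adjoin_id //.
exact: theta_gen.
Qed.

(** If [X (F :\ v) * u] became zero in the quotient, [colon_setU1] would put 1 into
    [face_prime (F :\ v)]. *)
Lemma clean_nonzero e N0 N : ideal N0 -> ideal N -> clean e.+1 N0 N ->
  (exists2 u, N u & ~ N0 u) -> exists2 u, N u & ~ add_mul N N0 (theta e.+1) u.
Proof.
move=> id0 idN cl; case: cl id0 idN => {N0 N} [N _ _ [u ? []]//|N0 N u F cF colon cl id0 idN _].
have Nu : N u.
  by rewrite -[u]mul1r; apply: (clean_sub cl); apply: adjoin_gen.
have /set0Pn[v vF] : F != set0 by rewrite -cards_eq0 cF.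
have reg x := clean_regular (x := x) (ideal_adjoin u id0) cl.
exists (X (F :\ v) * u); first exact: (ideal_mull idN).
move=> h; have vFv : v \notin F :\ v by rewrite !inE eqxx.
have [/(_ _)] := colon_setU1 id0 idN cF colon reg 1 vF vFv (subD1set _ _).
rewrite mul1r => /(_ (adjoin_sub _ h)) P1 _.
by have [_ []] := prime_face_prime k (F :\ v).
Qed.

(** The degrees decrease, because dividing by [theta e] leaves factors with one variable fewer. *)
Lemma clean_regular_sequence e N0 N : ideal N0 -> ideal N -> clean e N0 N ->
  (exists2 u, N u & ~ N0 u) ->
  @regular_sequence S S^o N N0 [seq theta e' | e' <- rev (iota 1 e)].
Proof.
elim: e N0 => [|e IH] N0 id0 idN cl ex; first by [].
rewrite -(addn1 e) iotaD rev_cat map_cat /= add1n; split.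
  by move=> u Nu; apply: (clean_regular id0 cl).
apply: IH => //.
- exact: ideal_add_mul.
- exact: clean_quotient.
- exact: clean_nonzero.
Qed.

Lemma clean_ann e N0 N : ideal N0 -> clean e N0 N -> (exists2 u, N u & ~ N0 u) ->
  exists2 F : {set 'I_n}, #|F| = e & forall a, @annihilator S S^o N N0 a -> face_prime F a.
Proof.
move=> id0 cl; case: cl id0 => {N0 N} [N _ [u ? []]//|N0 N u F cF colon cl id0 _].
exists F => // a ann; apply/colon; apply: ann.
by rewrite -[u]mul1r; apply: (clean_sub cl); apply: adjoin_gen.
Qed.

(** A shelling read backwards: adjoining [X R] to the ideal of the larger complex removes the
    interval from [R] to [F], and a monomial times [X R] stays outside that ideal exactly if its
    support lies in [F]. *)
Lemma clean_shells e D D' : down_closed D -> shells e D D' ->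
  clean e (@stanley_reisner k n D') (stanley_reisner D).
Proof.
move=> dD; elim=> [|{}D' R F S IH sRF cF RD' dD'']; first exact: clean_refl.
have dD' := shells_down_closed dD S.
apply: (@clean_step _ _ _ (X R) F) => // [a|]; last first.
  rewrite (_ : adjoin _ _ = stanley_reisner D') //; apply: pred_ext => f; split.
    move=> [y [a [Iy ->]]]; have id := ideal_stanley_reisner k dD'.
    apply: (idealD id).
      by apply: stanley_reisner_sub Iy; apply: subsetUl.
    by apply: (ideal_mull id); apply: stanley_reisnerX; rewrite supp_mesym1.
  move=> If; have [g [b [fE gE]]] := mpoly_splitX (mesym1 R) f.
  exists g, b; split=> // m; rewrite !inE gE mesym1_le => mD.
  case: ifP => // nR; case/orP: mD => [/If//|/andP[Rm _]].
  by rewrite Rm in nR.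
rewrite face_prime_coef; split=> [h m mF|h m'].
  rewrite -(mcoeffMX _ (mesym1 R)); apply: h; rewrite suppD supp_mesym1.
  by rewrite !inE subsetUl subUset sRF mF orbT.
have [le|nle _] := boolP (mesym1 R <= m')%MM; last exact: mcoeffMX_eq0.
rewrite -(submK le) addmC mcoeffMX suppD supp_mesym1 !inE subsetUl subUset sRF /=.
case/orP => [Rm|mF]; last exact: h.
by move: RD'; rewrite (dD' _ _ Rm) // subsetUl.
Qed.

End CleanFiltrations.

(** * Bounds on depth and dimension *)

Lemma exists_left_kernel (k : fieldType) p q (A : 'M[k]_(p, q)) :
  (q < p)%N -> exists2 v : 'rV_p, v != 0 & v *m A = 0.
Proof.
move=> ltqp; have kerA : kermx A != 0.
  rewrite kermx_eq0 /row_free neq_ltn; apply/orP; left.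
  exact: leq_ltn_trans (rank_leq_col _) ltqp.
exists (nz_row (kermx A)); first by rewrite nz_row_eq0.
by apply/sub_kermxP/nz_row_sub.
Qed.

Section Towers.
Variables (k : fieldType) (n : nat).
Local Notation S := {mpoly k[n]}.
Implicit Types (N Q : S -> Prop) (f u x : S) (fs : seq S) (m : 'X_{1..n}).

(* Common to regular sequences and to chains of primes: both give elements of
   which no nonzero polynomial can send [u] into [Q]. *)
Inductive tower N u : (S -> Prop) -> seq S -> Prop :=
| tower_nil Q : ~ Q u -> tower N u Q [::]
| tower_cons Q Q' f fs :
    (forall x, N x -> Q (f * x) -> Q x) -> (forall x, Q x -> Q' x) ->
    (forall x, N x -> Q' (f * x)) -> ideal Q' ->
    tower N u Q' fs -> tower N u Q (f :: fs).

(** Subadditivity of the degree: [msize] is the degree plus one for nonzero polynomials. *)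
Lemma msizeM_leq (p q : S) a b :
  (msize p <= a.+1)%N -> (msize q <= b.+1)%N -> (msize (p * q) <= (a + b).+1)%N.
Proof.
have [->|p0] := eqVneq p 0; first by rewrite mul0r msize0.
have [->|q0] := eqVneq q 0; first by rewrite mulr0 msize0.
move=> lep leq; rewrite msizeM //.
by rewrite -addnS -[(a + b.+1)%N]/((a.+1 + b.+1).-1) -!subn1 leq_sub2r // leq_add.
Qed.

Lemma msizeX_leq (p : S) i : (msize (p ^+ i) <= (i * msize p).+1)%N.
Proof.
elim: i => [|i IH]; first by rewrite expr0 msize1.
by rewrite exprS mulSn; apply: msizeM_leq.
Qed.

(* The coefficients of the terms without the first element [f] vanish modulo
   [Q'], by induction; then [f] can be cancelled modulo [Q]. *)
Lemma tower_free N u Q fs t : ideal N -> ideal Q -> N u -> tower N u Q fs ->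
  exists (I : finType) (g : I -> S),
  [/\ #|I| = (t ^ size fs)%N,
      forall i, (msize (g i) <= (t * \sum_(f <- fs) msize f).+1)%N
    & forall c : I -> k, Q (\sum_i (c i)%:MP * (g i * u)) -> forall i, c i = 0].
Proof.
move=> idN idQ Nu tow; elim: tow idQ => {Q fs} [Q nQu idQ|Q Q' f fs reg sQQ' Q'f idQ' _ IH idQ].
  exists unit, (fun=> 1); split=> [|i|c]; first by rewrite card_unit.
    by rewrite msize1.
  rewrite (big_pred1 tt) => [|[]//]; rewrite mul1r => Qcu [].
  have [//|c0] := eqVneq (c tt) 0; case: nQu.
  rewrite -[u]mul1r -(mpolyC1 n k) -(mulVf c0) mpolyCM -mulrA.
  exact: (ideal_mull idQ).
have [J [h [cJ szh free]]] := IH idQ'.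
(* The family consists of the products of powers of the tower elements with all exponents below
   [t]. *)
exists ('I_t * J)%type, (fun p : 'I_t * J => f ^+ p.1 * h p.2); split.
- by rewrite card_prod card_ord cJ expnS.
- move=> [i j] /=; rewrite big_cons mulnDr; apply: msizeM_leq (szh j).
  by apply: leq_trans (msizeX_leq _ _) _; rewrite ltnS leq_mul2r ltnW ?orbT.
have key t' (c : nat -> J -> k) :
    Q (\sum_(i < t') f ^+ i * \sum_j (c i j)%:MP * (h j * u)) ->
    forall i j, (i < t')%N -> c i j = 0.
  elim: t' c => [//|t' IHt] c.
  rewrite big_ord_recl expr0 mul1r.
  pose r := \sum_(i < t') f ^+ i * \sum_j (c i.+1 j)%:MP * (h j * u).
  have Nsum (d : J -> k) : N (\sum_j (d j)%:MP * (h j * u)).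
    by apply: (ideal_sum idN) => j _; do 2!apply: (ideal_mull idN).
  have Nr : N r by apply: (ideal_sum idN) => i _; apply: (ideal_mull idN).
  have -> : \sum_(i < t') f ^+ lift ord0 i *
      \sum_j (c (lift ord0 i) j)%:MP * (h j * u) = f * r.
    by rewrite /r mulr_sumr; apply: eq_bigr => i _; rewrite exprS mulrA.
  move=> Qs; have c0 : forall j, c 0%N j = 0.
    apply: free; rewrite -[X in Q' X](addrK (f * r)).
    by apply: (idealB idQ'); [apply: sQQ'|apply: Q'f].
  have Qr : Q r.
    apply: reg => //; move: Qs; rewrite big1 ?add0r // => j _.
    by rewrite c0 mpolyC0 mul0r.
  by case=> [//|i] j lt; apply: (IHt (fun i => c i.+1)).
move=> c Qc [i j].
(* Coefficients are extended by zero to all natural exponents, since [key] shifts them. *)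
have := key t (fun i j => if insub i is Some i' then c (i', j) else 0) _ i j (ltn_ord i).
rewrite valK; apply.
suff -> : \sum_(i0 < t) f ^+ i0 *
   (\sum_j0 (if insub (i0 : nat) is Some i' then c (i', j0) else 0)%:MP * (h j0 * u)) =
   \sum_i (c i)%:MP * (f ^+ i.1 * h i.2 * u) by [].
transitivity (\sum_(i < t) \sum_j (c (i, j))%:MP * (f ^+ i * h j * u)); last first.
  by rewrite pair_bigA; apply: eq_bigr => -[].
apply: eq_bigr => i' _; rewrite mulr_sumr; apply: eq_bigr => j' _.
by rewrite valK; ring.
Qed.

(** A set of variables and [e] exponents below [T]. Repetitions are harmless: only an upper bound
    for the number of such monomials is wanted. *)
Definition monomial_of e T (p : {set 'I_n} * {ffun 'I_e -> 'I_T}) : 'X_{1..n} :=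
  [multinom if i \in p.1 then nth 0%N [seq val (p.2 j) | j <- enum 'I_e]
                                (index i (enum p.1)) else 0%N | i < n].

Lemma monomial_of_surj e T m : (#|supp m| <= e)%N -> (forall i, m i <= T)%N ->
  exists p : {set 'I_n} * {ffun 'I_e -> 'I_T.+1}, m = monomial_of p.
Proof.
move=> me mT.
exists (supp m, [ffun j : 'I_e => inord (nth 0%N [seq m i | i <- enum (supp m)] j)]).
apply/mnmP=> i; rewrite mnmE /=; case: ifPn => im; last first.
  by apply/eqP; move: im; rewrite inE negbK.
have lti : (index i (enum (supp m)) < #|supp m|)%N.
  by rewrite cardE index_mem mem_enum.
have lte := leq_trans lti me.
rewrite (nth_map (Ordinal lte)) ?size_enum_ord // ffunE /= nth_enum_ord //.
by rewrite (nth_map i) -?cardE // nth_index ?mem_enum // inordK // ltnS.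
Qed.

(** A longer tower yields at least [t ^ e.+1] elements independent modulo [Q], but by degree only
    [2 ^ n * T.+1 ^ e] coefficients decide membership in [Q]. Linear algebra gives a nontrivial
    combination on which all of these vanish. *)
Lemma size_tower_leq N u Q fs e : ideal N -> ideal Q -> N u -> tower N u Q fs ->
  (forall x, N x -> (forall m, (#|supp m| <= e)%N -> x@_m = 0) -> Q x) ->
  (size fs <= e)%N.
Proof.
move=> idN idQ Nu tow bnd; rewrite leqNgt; apply/negP => ltes.
pose s := (\sum_(f <- fs) msize f)%N.
pose D := (s + msize u).+1.
(* As [T.+1 <= t * D] below, this choice makes [2 ^ n * T.+1 ^ e] smaller than [t ^ e.+1]. *)
pose t := (2 ^ n * D ^ e).+1.
have [I [g [cI szg free]]] := tower_free t idN idQ Nu tow.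
pose T := (t * s + msize u)%N.
pose Col := ({set 'I_n} * {ffun 'I_e -> 'I_T.+1})%type.
have cCol : (#|{: Col}| < #|I|)%N.
  rewrite cI card_prod card_ffun !card_ord -cardsT -powersetT card_powerset cardsT card_ord.
  have le1 : (T.+1 <= t * D)%N by rewrite /T /D; nia.
  apply: (@leq_ltn_trans (2 ^ n * D ^ e * t ^ e)).
    rewrite -mulnA -expnMn leq_mul2l (mulnC D); apply/orP; right.
    by case: (posnP e) => [->//|e0]; rewrite leq_exp2r.
  apply: (@leq_trans (t ^ e.+1)); last by rewrite leq_pexp2l.
  by rewrite expnS ltn_pmul2r ?expn_gt0.
pose A := \matrix_(i < #|I|, j < #|{: Col}|)
  (g (enum_val i) * u)@_(monomial_of (enum_val j)).
have [v v0 vA] := exists_left_kernel A cCol.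
case/negP: v0; apply/eqP/rowP=> i; rewrite mxE.
pose c i := v ord0 (enum_rank i).
have := free c _ (enum_val i); rewrite /c enum_valK; apply.
apply: bnd => [|m me].
  by apply: (ideal_sum idN) => j _; do 2!apply: (ideal_mull idN).
rewrite raddf_sum /=.
(* Monomials with exponents up to [T] are columns of [A]; all others exceed the degree of every
   [g i * u]. *)
have [mT|] := boolP [forall i, m i <= T]%N.
  have [p mp] := monomial_of_surj me (fun i => forallP mT i).
  have := congr1 (fun B : 'rV_ _ => B ord0 (enum_rank p)) vA; rewrite !mxE => vp; rewrite -[RHS]vp.
  rewrite (reindex (@enum_val I xpredT)); last first.
    by apply/onW_bij/enum_val_bij.
  by apply: eq_bigr => j _; rewrite mxE mcoeffCM enum_valK enum_rankK -mp.
move=> /forallPn[j]; rewrite -ltnNge => Tj; apply: big1 => i' _.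
rewrite mcoeffCM; apply/eqP; rewrite mulf_eq0; apply/orP; right.
rewrite mcoeff_eq0; apply: msize_mdeg_ge.
have mjd : (m j <= mdeg m)%N by rewrite mdegE (bigD1 j) //= leq_addr.
apply: leq_trans (_ : T.+1 <= _)%N; last exact: leq_trans mjd.
apply: msizeM_leq; first exact: szg.
by [].
Qed.

Lemma regular_sequence_tower N N0 fs : ideal N -> ideal N0 ->
  @regular_sequence S S^o N N0 fs -> exists2 u, N u & tower N u N0 fs.
Proof.
move=> idN; elim: fs N0 => [|f fs IH] N0 id0 /= => [[u Nu nu]|[reg rs]].
  by exists u => //; apply: tower_nil.
have [u Nu tow] := IH _ (ideal_add_mul f idN id0) rs.
exists u => //; apply: tower_cons tow.
- by move=> x Nx; apply: reg.
- by move=> x N0x; exists 0, x; split; [exact: ideal0|by []|rewrite scaler0 addr0].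
- by move=> x Nx; exists x, 0; split; [by []|exact: ideal0|rewrite add0r].
- exact: ideal_add_mul.
Qed.

(** The tower elements are chosen in each prime outside the preceding one, and primality gives the
    cancellation. *)
Lemma prime_chain_tower I l P : @prime_chain S I l P ->
  exists2 fs, size fs = l & tower (fun=> True) 1 (P 0%N) fs.
Proof.
elim: l I P => [|l IH] I P [prP IP Pinc].
  by exists [::] => //; apply: tower_nil; have [] := prP 0%N isT.
have [|fs sz tow] := IH (P 1%N) (fun i => P i.+1).
  split=> //; first by move=> i il; exact: (prP i.+1).
  by move=> i il; exact: (Pinc i.+1).
have [sP [f P1f nP0f]] := Pinc 0%N isT.
have [_ _ pr0] := prP 0%N isT; have [id1 _ _] := prP 1%N isT.
exists (f :: fs); first by rewrite /= sz.
apply: tower_cons tow => //.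
- by move=> x _ /pr0[].
- by move=> x _; apply: (ideal_mulr id1).
Qed.

End Towers.

(** * Sequential Cohen-Macaulayness *)

Section CohenMacaulay.
Variables (k : fieldType) (n : nat).
Local Notation S := {mpoly k[n]}.
Local Notation SR := (@stanley_reisner k n).
Implicit Types (N : S -> Prop) (D : {set {set 'I_n}}) (F : {set 'I_n}).

Lemma ideal_setT : ideal (fun _ : S => True). Proof. by []. Qed.

(** The elements of [F] are dropped one by one; each drop adds a variable to the prime. *)
Lemma face_prime_chain (I : S -> Prop) F :
  (forall a, I a -> face_prime F a) ->
  exists P, @prime_chain S I #|F| P.
Proof.
move=> IF; exists (fun i => face_prime [set x in drop i (enum F)]); split.
- by move=> i _; apply: prime_face_prime.
- by move=> a /IF; rewrite drop0 set_enum.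
move=> i; rewrite cardE => lti; have uF := enum_uniq F.
have : uniq (drop i (enum F)) by apply: drop_uniq.
rewrite -add1n -drop_drop; have : size (drop i (enum F)) != 0%N.
  by rewrite size_drop subn_eq0 -ltnNge.
case: (drop i _) => [//|x s _ /=]; rewrite drop0 => /andP[xs _]; split.
  move=> a; apply: stanley_reisner_sub; rewrite powersetS.
  by apply/subsetP=> y; rewrite !inE => ->; rewrite orbT.
exists 'X_x; first by apply/face_primeX; rewrite suppU sub1set inE.
by move/face_primeX; rewrite suppU sub1set !inE eqxx.
Qed.

(** The chain above an annihilator inside some [face_prime F] gives the lower bound. For the upper
    one, polynomials without monomials in at most [e] variables annihilate, hence lie in the first
    prime of any chain. *)
Lemma clean_has_dim e N0 N : ideal N0 -> ideal N -> clean e N0 N ->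
  (exists2 u, N u & ~ N0 u) ->
  (forall x, (forall m, (#|supp m| <= e)%N -> x@_m = 0) -> @annihilator S S^o N N0 x) ->
  @has_dim S S^o N N0 e.
Proof.
move=> id0 idN cl nz bnd; split.
  by have [F <- /face_prime_chain] := clean_ann id0 cl nz.
move=> l P ch; have [fs <- tow] := prime_chain_tower ch.
have [prP annP _] := ch; have [idP _ _] := prP 0%N isT.
by apply: (size_tower_leq ideal_setT idP _ tow) => // x _ /bnd/annP.
Qed.

Lemma clean_has_depth e N0 N : ideal N0 -> ideal N -> clean e N0 N ->
  (exists2 u, N u & ~ N0 u) ->
  (forall x, N x -> (forall m, (#|supp m| <= e)%N -> x@_m = 0) -> N0 x) ->
  @has_depth S S^o (@max_ideal k n) N N0 e.
Proof.
move=> id0 idN cl nz bnd; split.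
  exists [seq (mesym n k e' : S) | e' <- rev (iota 1 e)].
    by rewrite size_map size_rev size_iota.
  split; last exact: clean_regular_sequence.
  move=> _ /mapP[e' + ->]; rewrite mem_rev mem_iota => /andP[e'0 _].
  by rewrite /max_ideal mcoeff_mesym /mechar mdeg0 eq_sym eqn0Ngt e'0.
move=> fs [_ /(regular_sequence_tower idN id0)[u Nu tow]].
exact: size_tower_leq tow bnd.
Qed.

Lemma Cohen_Macaulay_shells e D D' : down_closed D -> down_closed D' ->
  shells e D D' -> D != D' ->
  @has_dim S S^o (SR D) (SR D') e /\
  @has_depth S S^o (@max_ideal k n) (SR D) (SR D') e.
Proof.
move=> dD dD' sh neq; have cl := clean_shells k dD sh.
have id := ideal_stanley_reisner k dD; have id' := ideal_stanley_reisner k dD'.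
have nz : exists2 u, SR D u & ~ SR D' u.
  have /properP[_ [F FD' FD]] : D \proper D' by rewrite properEneq neq (shells_subset sh).
  exists 'X_[mesym1 F]; first by apply: stanley_reisnerX; rewrite supp_mesym1.
  move/(_ (mesym1 F)); rewrite supp_mesym1 mcoeffX eqxx => /(_ FD')/eqP.
  by rewrite oner_eq0.
have bnd x : SR D x -> (forall m, (#|supp m| <= e)%N -> x@_m = 0) -> SR D' x.
  move=> Dx x0 m mD'; have [/Dx//|mD] := boolP (supp m \in D).
  exact/x0/(shells_card sh).
split; [apply: clean_has_dim|apply: clean_has_depth] => // x x0 u Du.
apply: bnd; first exact: (ideal_mull id).
(* Having no monomial in at most [e] variables means lying in the ideal of [K], so it survives
   multiplication by [u]. *)
pose K := [set E : {set 'I_n} | #|E| <= e]%N.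
have dK : down_closed K.
  by move=> E F; rewrite !inE => Fe /subset_leq_card /leq_trans; apply.
have Kx : SR K (x * u).
  apply: (ideal_mulr (ideal_stanley_reisner k dK)) => m; rewrite inE; exact: x0.
by move=> m me; apply: Kx; rewrite inE.
Qed.

Lemma sequentially_CM_stanley_reisner D :
  down_closed D -> shed_dec D -> sequentially_CM (SR D).
Proof.
move=> dD sD.
pose Dp e := pure_part e D.
have dDp e : down_closed (Dp e) by apply: down_closed_pure_part.
(* The filtration is built by descending [e], from the void complex at [n.+1]. The clause on the
   first quotient secures strict growth of dimensions when a step is prepended. *)
suff filt j e : (e + j = n.+1)%N -> exists (l : nat) (J : nat -> S -> Prop),
    [/\ J 0%N = SR (Dp e), forall f, J l f, 
        forall i, (i <= l)%N -> graded_ideal (J i),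
        forall i, (i < l)%N ->
          (forall f, J i f -> J i.+1 f) /\ Cohen_Macaulay (J i.+1) (J i)
      & forall i, (i.+1 < l)%N -> dim_lt (J i.+1) (J i) (J i.+2) (J i.+1)] /\
    ((0 < l)%N -> exists2 d, (e <= d)%N & @has_dim S S^o (J 1%N) (J 0%N) d).
  have [l [J [[J0 Jl Jg Jcm Jd] _]]] := filt n.+1 0%N erefl.
  exists l, J; split=> // f; rewrite J0 /Dp (_ : pure_part 0 D = D) //.
  apply/setP=> E; rewrite inE; have [ED|//] := boolP (E \in D).
  by apply/existsP; exists E; rewrite ED subxx.
elim: j e => [|j IH] e ej.
  exists 0%N, (fun=> SR (Dp e)); split=> //; split=> //.
    move=> f m; rewrite inE => /andP[_ /existsP[F /and3P[_ _ eF]]].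
    by have := leq_trans eF (max_card _); rewrite card_ord -[e]addn0 ej ltnn.
  by move=> i _; apply: graded_stanley_reisner.
have [|l [J [[J0 Jl Jg Jcm Jd] Jh]]] := IH e.+1; first by rewrite addSnnS.
(* Equal complexes would give a zero quotient, which is not Cohen-Macaulay; no step is added
   then. *)
have [eqD|neqD] := eqVneq (Dp e.+1) (Dp e).
  exists l, J; rewrite -eqD; split=> // /Jh[d ed ?].
  by exists d => //; apply: ltnW.
have sh : shells e (Dp e.+1) (Dp e) by apply: shells_pure_part.
have [hdim hdep] := Cohen_Macaulay_shells (dDp _) (dDp _) sh neqD.
pose J' i := if i is i'.+1 then J i' else SR (Dp e).
exists l.+1, J'; split; last by exists e; rewrite //= J0.
split=> //.
- by case=> [_|i]; [exact: graded_stanley_reisner|apply: Jg].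
- case=> [_|i]; last exact: Jcm.
  rewrite /= J0; split; last by exists e.
  by move=> f; apply/stanley_reisner_sub/(shells_subset sh).
case=> [l0|i]; last exact: Jd.
have [d ed hd] := Jh l0; rewrite /= J0; exists e, d; split=> //.
by rewrite -J0.
Qed.

End CohenMacaulay.

(** * The edge ideal as a Stanley-Reisner ideal *)

Lemma submodule_span (R : comNzRingType) (M : lmodType R) (X : M -> Prop) :
  submodule (Defs.span X).
Proof.
split=> [|_ _ [s Xs ->] [s' Xs' ->]|a _ [s Xs ->]].
- by exists [::]; rewrite ?big_nil.
- exists (s ++ s'); rewrite ?big_cat // => c.
  by rewrite mem_cat => /orP[/Xs|/Xs'].
exists [seq (a * c.1, c.2) | c <- s]; first by move=> _ /mapP[c /Xs ? ->].
by rewrite big_map scaler_sumr; apply: eq_bigr => c _; rewrite scalerA.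
Qed.

(** A monomial whose support is not independent is divisible by the generator of an edge;
    [enum_rank] translates vertices into variables. *)
Lemma edge_ideal_stanley_reisner (k : fieldType) (T : finType) (H : sgraph T) f :
  stanley_reisner [set enum_rank @: F | F : {set T} in Ind H] f <-> edge_ideal k H f.
Proof.
set D := [set _ | _ in _].
have dD : down_closed D := down_closed_imset enum_rank_inj (@down_closed_Ind T H).
have idD := ideal_stanley_reisner k dD.
have idE : ideal (edge_ideal k H) by apply: submodule_span.
split=> [If|[s Xs ->]]; last first.
  rewrite big_seq; apply: (ideal_sum idD) => c /Xs[u [v [uv ->]]].
  apply: (ideal_mull idD); rewrite -mpolyXD; apply: stanley_reisnerX.
  rewrite suppD !suppU; apply/negP => /imsetP[F /in_Ind iF eqF].
  have mem t : enum_rank t \in [set enum_rank u] :|: [set enum_rank v] -> t \in F.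
    by rewrite eqF mem_imset //; apply: enum_rank_inj.
  by have := iF u v; rewrite uv !mem ?inE ?eqxx ?orbT // => /(_ isT isT).
rewrite (mpolyE f) big_seq; apply: (ideal_sum idE) => m mf.
pose F := [set t | enum_rank t \in supp m].
have mF : supp m = enum_rank @: F.
  apply/setP=> i; apply/idP/imsetP => [im|[t + ->]]; last by rewrite inE.
  by exists (enum_val i); rewrite ?enum_valK // inE enum_valK.
have : F \notin Ind H.
  apply: contraL mf => FI; rewrite -mcoeff_eq0 If // mF.
  by apply: imset_f.
rewrite inE => /forall_inPn[u uF /forall_inPn[v vF]]; rewrite negbK => uv.
(* Without loops the two variables differ, so their product divides the monomial even if its
   exponents are 1. *)
have ruv : enum_rank u != enum_rank v.
  by apply: contraTneq uv => /enum_rank_inj->; rewrite edge_irr.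
have le : (U_(enum_rank u) + U_(enum_rank v) <= m)%MM.
  apply/mnm_lepP => i; rewrite mnmDE !mnm1E; move: uF vF; rewrite !inE -!lt0n.
  have [<-|_] := eqVneq (enum_rank u) i; first by rewrite eq_sym (negPf ruv).
  by have [<-|] := eqVneq (enum_rank v) i.
rewrite -(submK le) !mpolyXD scalerAl; apply: (ideal_mull idE).
exists [:: (1, 'X_(enum_rank u) * 'X_(enum_rank v))]; last by rewrite big_seq1 scale1r.
by move=> c; rewrite inE => /eqP->; exists u, v.
Qed.

Theorem corollary4p6 (k : fieldType) (V : finType) (G : sgraph V)
    (d s r : nat) (W : 'I_d -> {set V}) (U : 'I_s -> {set V})
    (r_le_s : (r <= s)%N)
    (A : 'I_d -> finType) (B : 'I_r -> finType)
    (GA : forall i, sgraph (A i)) (GB : forall j, sgraph (B j))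
    (W_clique : clique_partition G W)
    (U_cluster : cluster_partition G W U)
    (U_first : clusters_first W U r)
    (A_nonempty : forall i, (0 < #|A i|)%N)
    (B_nonempty : forall j, (0 < #|B j|)%N)
    (GA_vd : forall i, vd_graph (GA i))
    (GB_vd : forall j, vd_graph (GB j)) :
  sequentially_CM (edge_ideal k (md_graph G W U r_le_s GA GB)).
Proof.
rewrite -(pred_ext (@edge_ideal_stanley_reisner k _ _)).
apply: sequentially_CM_stanley_reisner.
  exact: down_closed_imset enum_rank_inj (@down_closed_Ind _ _).
apply: shed_dec_imset enum_rank_inj _.
exact: shed_dec_md_graph.
Qed.
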